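(* Let $B$ be a finite Blaschke product of degree $n$ whose Blaschke curve is an ellipse. Then for each factor $k>1$ of $n$, there exist a Blaschke product $C$ of degree $k$ and a Blaschke product $D$ of degree $n/k$ such that $B=C\circ D$.
   Context: A finite Blaschke product of degree $d$ is $B(z)=\gamma\prod_{j=1}^d \frac{z-a_j}{1-\overline{a_j}z}$ with $a_j\in\mathbb{D}$ and $|\gamma|=1$. The Blaschke curve of $B$ is the curve in $\mathbb{D}$ inscribed in all the convex polygons whose vertices are the solutions $z\in\mathbb{T}$ of $B(z)=\lambda$, as $\lambda$ ranges over the unit circle $\mathbb{T}$; each point of the curve is a point of tangency of a side of such a polygon. *)

(* Defs.v *)
From HB Require Import structures.
From mathcomp Require Import all_boot all_order all_algebra.
From mathcomp Require Import complex.
From mathcomp Require Import reals.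
Set Implicit Arguments. Unset Strict Implicit. Unset Printing Implicit Defensive.
Import Order.TTheory GRing.Theory Num.Theory.
Local Open Scope ring_scope.

Section Blaschke.
Variable R : realType.
Local Notation C := R[i].

Definition blaschke (d : nat) (g : C) (a : d.-tuple C) (z : C) : C :=
  g * \prod_(j < d) ((z - tnth a j) / (1 - (tnth a j)^* * z)).

Definition blaschke_data (d : nat) (g : C) (a : d.-tuple C) : Prop :=
  `|g| = 1 /\ forall j : 'I_d, `|tnth a j| < 1.

Definition vertex (B : C -> C) (lam z : C) : Prop := `|z| = 1 /\ B z = lam.

Definition cross (u v w : C) : C := 'Im ((v - u)^* * (w - u)).

(** [u,v] is a side of the convex polygon with vertex set {z | vertex B lam z}:
    u, v are distinct vertices and all vertices lie in one closed half-plane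
    bounded by the line uv. *)
Definition side (B : C -> C) (lam u v : C) : Prop :=
  vertex B lam u /\ vertex B lam v /\ u <> v /\
  ((forall w, vertex B lam w -> 0 <= cross u v w) \/
   (forall w, vertex B lam w -> cross u v w <= 0)).

(** z lies in the closed convex polygon (convex hull of the vertices), i.e.
    in every closed half-plane {w | Re(conj(c) w) <= r} containing all vertices. *)
Definition in_polygon (B : C -> C) (lam z : C) : Prop :=
  forall (c : C) (r : R),
    (forall w, vertex B lam w -> 'Re (c^* * w) <= r%:C%C) -> 'Re (c^* * z) <= r%:C%C.

Definition on_segment (u v z : C) : Prop :=
  exists t : R, 0 <= t <= 1 /\ z = u + t%:C%C * (v - u).

Definition ellipse (f1 f2 : C) (a : R) (z : C) : Prop :=
  `|z - f1| + `|z - f2| = (2 * a)%:C%C.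

Definition nondeg_ellipse (f1 f2 : C) (a : R) : Prop :=
  `|f1 - f2| < (2 * a)%:C%C.

(** The Blaschke curve of B is the set E: E is inscribed in every polygon
    (contained in it and touching every side), and every point of E is a
    point of tangency of a side of such a polygon. *)
Definition blaschke_curve_is (B : C -> C) (E : C -> Prop) : Prop :=
  (forall lam, `|lam| = 1 -> forall z, E z -> in_polygon B lam z) /\
  (forall lam, `|lam| = 1 -> forall u v, side B lam u v ->
      exists z, E z /\ on_segment u v z) /\
  (forall z, E z -> exists lam u v,
      `|lam| = 1 /\ side B lam u v /\ on_segment u v z).

Definition blaschke_curve_is_ellipse (B : C -> C) : Prop :=
  exists (f1 f2 : C) (a : R),
    nondeg_ellipse f1 f2 a /\ blaschke_curve_is B (ellipse f1 f2 a).

End Blaschke.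

(* Main.v *)
Require Import Defs.
From HB Require Import structures.
From mathcomp Require Import all_boot all_order all_algebra.
From mathcomp Require Import separable.
From mathcomp Require Import complex.
From mathcomp Require Import boolp reals.
From mathcomp Require Import ring zify.
Set Implicit Arguments. Unset Strict Implicit. Unset Printing Implicit Defensive.
Import Order.TTheory GRing.Theory Num.Theory.
Local Open Scope ring_scope.

(** Write [B = N / M].  A chord [uv] of the unit circle is tangent to the ellipse iff [u] and [v]
    satisfy a symmetric equation of degree 2 in each variable, so the two neighbours of a vertex
    [z] in its polygon are the roots of a quadratic polynomial whose coefficients are polynomials
    in [z].  By induction on [j], the two vertices at distance [j] from [z] have a sum and a product
    that are rational in [z]; hence so are the coefficients of [Phi_z(Y)], the product of [Y - y]
    over every [k]-th vertex [y] of the polygon, starting from [z].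

    As in the proof of Lueroth's theorem, clearing denominators in [Phi_z(Y)] gives a factor
    [A(X, Y)] of [N(Y) M(X) - N(X) M(Y)], whose slices [A(X, w)] are multiples of [Phi_w(X)] because
    "[z] and [w] are [k j] steps apart" is a symmetric relation.  It follows that all [Phi_z] lie in
    the pencil spanned by two polynomials [P], [Q] of degree [n / k] with roots on the circle.
    The polynomial [M(z) N - N(z) M] of a polygon is a product of [k] members of this pencil, and so
    is [N].  The roots of [N] lie in the disk, and the pencil is stable under [p(z) |-> z^m p(1/z^* )^*],
    so it is spanned by the numerator and the denominator of a Blaschke product [D], in terms of
    which the factorization of [N] reads [B = C o D]. *)

(** * Rational functions on the unit circle *)

Section Circle.
Variable C : numClosedFieldType.
Implicit Types (z w : C) (p q : {poly C}) (A B : {poly {poly C}}).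

Lemma circle_neq0 z : `|z| = 1 -> z != 0.
Proof. by move=> hz; rewrite -normr_gt0 hz ltr01. Qed.

Lemma circle_conj z : `|z| = 1 -> z^* = z^-1.
Proof. by move=> hz; rewrite invC_norm hz expr1n invr1 mul1r. Qed.

Lemma circle_not_root p : p != 0 -> exists2 z, `|z| = 1 & p.[z] != 0.
Proof.
move=> p0.
(* The Cayley transform maps the naturals injectively into the circle, so [size p] of these points
   cannot all be roots. *)
pose c (t : nat) : C := (1 + t%:R * 'i) / (1 - t%:R * 'i).
have den (t : nat) : 1 - t%:R * 'i != 0 :> C.
  apply/negP => /eqP h; have: 'Re (1 - t%:R * 'i) = 0 :> C by rewrite h raddf0.
  by rewrite raddfB /= (ReMir) (Creal_ReP _ _) ?rpred1 // (Creal_ImP _ _) ?rpred_nat //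
     oppr0 subr0 => /eqP; rewrite oner_eq0.
have c1 t : `|c t| = 1.
  have hc : (1 + t%:R * 'i)^* = 1 - t%:R * 'i :> C.
    by rewrite rmorphD rmorphM /= rmorph1 rmorph_nat conjCi mulrN.
  rewrite normrM normfV -hc norm_conjC divff // normr_eq0 -conjC_eq0 hc; exact: den.
have cinj : injective c.
  move=> t u /eqP; rewrite eqr_div ?den // => h.
  have : 2%:R * 'i * (t%:R - u%:R) = 0 :> C.
    rewrite -subr_eq0 in h; rewrite -(eqP h); ring.
  move/eqP; rewrite !mulf_eq0 pnatr_eq0 (negbTE (neq0Ci C)) /= subr_eq0 eqr_nat.
  by move/eqP.
case: (boolP (all (root p) (map c (iota 0 (size p))))) => [h|].
  have u : uniq (map c (iota 0 (size p))) by rewrite map_inj_uniq ?iota_uniq.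
  by have := max_poly_roots p0 h u; rewrite size_map size_iota ltnn.
case/allPn => z /mapP[t _ ->] h; exists (c t) => //.
Qed.

Lemma eq_on_circle p q :
  (forall z, `|z| = 1 -> p.[z] = q.[z]) -> p = q.
Proof.
move=> h; apply/eqP; rewrite -subr_eq0; apply/negP => /negP/circle_not_root[z hz].
by rewrite hornerD hornerN h // subrr eqxx.
Qed.

(* In {poly {poly C}} the inner variable is X and the outer one is Y. *)
Definition evalX z A : {poly C} := map_poly (horner_eval z) A.

HB.instance Definition _ z := GRing.RMorphism.copy (evalX z) (map_poly (horner_eval z)).

Lemma coef_evalX z A i : (evalX z A)`_i = (A`_i).[z].
Proof. by rewrite coef_map. Qed.

Lemma evalXC z p : evalX z p%:P = p.[z]%:P.
Proof. by rewrite /evalX map_polyC. Qed.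

Lemma evalXM z A B : evalX z (A * B) = evalX z A * evalX z B.
Proof. exact: rmorphM. Qed.

Lemma evalXB z A B : evalX z (A - B) = evalX z A - evalX z B.
Proof. exact: rmorphB. Qed.

Lemma eq_evalX_circle A B :
  (forall z, `|z| = 1 -> evalX z A = evalX z B) -> A = B.
Proof.
move=> h; apply/polyP => i; apply: eq_on_circle => z hz.
by rewrite -!coef_evalX h.
Qed.

(** The denominator [c] may vanish at finitely many points of the circle; there the equation says
    nothing about [f z]. *)
Definition rational_on_circle (f : C -> {poly C}) : Prop :=
  exists (c : {poly C}) A, c != 0 /\
    forall z, `|z| = 1 -> c.[z] *: f z = evalX z A.

Lemma rational_ext (f g : C -> {poly C}) :
  (forall z, `|z| = 1 -> f z = g z) -> rational_on_circle f -> rational_on_circle g.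
Proof. by move=> e [c [A [c0 h]]]; exists c, A; split=> // z hz; rewrite -e // h. Qed.

Lemma rational_bipoly A : rational_on_circle (fun z => evalX z A).
Proof. by exists 1, A; split; rewrite ?oner_eq0 // => z _; rewrite hornerC scale1r. Qed.

Lemma rational_poly p : rational_on_circle (fun z => p.[z]%:P).
Proof. by apply: rational_ext (rational_bipoly p%:P) => z _; rewrite evalXC. Qed.

Lemma rational_const p : rational_on_circle (fun=> p).
Proof.
apply: rational_ext (rational_bipoly (map_poly polyC p)) => z _.
apply/polyP => i; rewrite coef_evalX coef_map /= hornerC //.
Qed.

Lemma rationalD (f g : C -> {poly C}) : rational_on_circle f -> rational_on_circle g ->
  rational_on_circle (fun z => f z + g z).
Proof.
move=> [c [A [c0 hA]]] [d [B [d0 hB]]].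
exists (c * d), (d%:P * A + c%:P * B); split=> [|z hz]; first by rewrite mulf_neq0.
rewrite rmorphD !rmorphM /= !evalXC -hA // -hB // !mul_polyC !scalerA hornerM.
by rewrite scalerDr [d.[z] * _]mulrC.
Qed.

Lemma rationalM (f g : C -> {poly C}) : rational_on_circle f -> rational_on_circle g ->
  rational_on_circle (fun z => f z * g z).
Proof.
move=> [c [A [c0 hA]]] [d [B [d0 hB]]].
exists (c * d), (A * B); split=> [|z hz]; first by rewrite mulf_neq0.
by rewrite !rmorphM /= -hA // -hB // hornerM -scalerAl -scalerAr scalerA.
Qed.

Lemma rationalN (f : C -> {poly C}) : rational_on_circle f ->
  rational_on_circle (fun z => - f z).
Proof.
move=> hf; apply: rational_ext (rationalM (rational_const (-1)) hf) => z _.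
by rewrite mulN1r.
Qed.

Lemma rationalB (f g : C -> {poly C}) : rational_on_circle f -> rational_on_circle g ->
  rational_on_circle (fun z => f z - g z).
Proof. by move=> hf hg; apply: rationalD => //; apply: rationalN. Qed.

Lemma rationalV (f : C -> C) : (forall z, `|z| = 1 -> f z != 0) ->
  rational_on_circle (fun z => (f z)%:P) ->
  rational_on_circle (fun z => (f z)^-1%:P).
Proof.
move=> f0 [c [A [c0 hA]]].
have hA0 z : `|z| = 1 -> c.[z] * f z = (A`_0).[z].
  by move=> hz; rewrite -coef_evalX -hA // coefZ coefC.
exists A`_0, c%:P; split=> [|z hz].
  apply: contraNneq c0 => A0; apply/eqP; apply: eq_on_circle => z hz.
  apply: (mulIf (f0 z hz)); by rewrite hA0 // A0 !hornerC mul0r.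
by rewrite evalXC -hA0 // -mul_polyC -rmorphM /= mulfK // f0.
Qed.

(* Pairing the factors i and n - i; for even n the middle factor stays alone. *)
Lemma rational_paired_prod (n : nat) (f : nat -> C -> {poly C}) :
  rational_on_circle (f 0%N) ->
  (forall i, (0 < i < n)%N -> rational_on_circle (fun z => f i z * f (n - i)%N z)) ->
  (forall i, i.*2 = n -> rational_on_circle (f i)) ->
  rational_on_circle (fun z => \prod_(0 <= i < n) f i z).
Proof.
move=> h0 hp hm.
(* The condition [a + b = n + 1] makes the range from [a] to [b - 1] stable under [i |-> n - i]; the
   induction peels off both ends. *)
suff key d : forall a b, (0 < a)%N -> (a <= b)%N -> (a + b = n.+1)%N -> (b - a <= d)%N ->
    rational_on_circle (fun z => \prod_(a <= i < b) f i z).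
  case: n {hm} hp key => [|n] hp key.
    by apply: rational_ext (rational_const 1) => z _; rewrite big_geq.
  apply: (@rational_ext (fun z => f 0%N z * \prod_(1 <= i < n.+1) f i z)).
    by move=> z _; rewrite [in RHS]big_ltn.
  by apply: rationalM => //; apply: (key n.+1) => //; rewrite leq_subr.
elim/ltn_ind: d => d IH a b a0 ab abn hd.
case: (ltngtP a b) ab => // [ltab|eab] _; last first.
  by apply: rational_ext (rational_const 1) => z _; rewrite eab big_geq.
case: (ltngtP a.+1 b) ltab => // [ltab|eab] _; last first.
  apply: (@rational_ext (f a)) => [z _|]; first by rewrite -eab big_nat1.
  by apply: hm; move: abn; rewrite -eab addnS -addnn => - [].
case: b ltab abn hd => // b ltab abn hd.
have eb : b = (n - a)%N by lia.
apply: (@rational_ext (fun z => (f a z * f b z) * \prod_(a.+1 <= i < b) f i z)).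
  move=> z _; rewrite [RHS]big_ltn; last by lia.
  by rewrite big_nat_recr /=; [ring | lia].
apply: rationalM.
  by rewrite eb; apply: hp; lia.
have db : (b - a.+1 < d)%N by lia.
by apply: (IH _ db) => //; lia.
Qed.

End Circle.

(** * Gauss's lemma and products of members of a pencil *)

Section Factoring.
Variable C : numClosedFieldType.
Implicit Types (z w : C) (p q F H : {poly C}) (A B G : {poly {poly C}}).

Lemma size_mul_XsubC p z : p != 0 -> size (p * ('X - z%:P)) = (size p).+1.
Proof. by move=> p0; rewrite size_Mmonic ?monicXsubC // size_XsubC addn2. Qed.

Lemma evalX_eq0 z A : evalX z A = 0 -> exists B, A = ('X - z%:P)%:P * B.
Proof.
move=> h; exists (map_poly (fun p => p %/ ('X - z%:P)) A).
apply/polyP => i; rewrite coefCM coef_map_id0 ?div0p // mulrC divpK //.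
by rewrite dvdp_XsubCl; apply/rootP; rewrite -coef_evalX h coef0.
Qed.

(** Gauss's lemma: a linear factor [X - r] of [c] divides [A] or [B], because setting [X] to [r]
    lands in an integral domain. The factors taken from [A] are collected in [u]. *)
Lemma gauss_content c G A B : c != 0 -> c%:P * G = A * B ->
  exists (u : {poly C}) A1 B1, [/\ u != 0, A = u%:P * A1 & G = A1 * B1].
Proof.
have [k] := ubnP (size c); elim: k c A B => // k IH c A B hk c0 e.
case: (boolP (size c == 1)%N) => [/size_poly1P[d d0 ed]|/closed_rootP[r rr]].
  exists 1, A, (d^-1%:P%:P * B); split; rewrite ?oner_eq0 ?mul1r //.
  by rewrite mulrCA -e ed mulrA -!rmorphM /= mulVf // !rmorph1 mul1r.
have Xr0 : ('X - r%:P)%:P != 0 :> {poly {poly C}} by rewrite polyC_eq0 polyXsubC_eq0.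
move: rr; rewrite -dvdp_XsubCl => /dvdpP[c' ec].
have c'0 : c' != 0 by apply: contraNneq c0 => z; rewrite ec z mul0r.
have sc' : (size c' < k)%N by move: hk; rewrite ec size_mul_XsubC.
have : evalX r A * evalX r B == 0.
  rewrite -rmorphM -e rmorphM /= evalXC ec hornerM hornerXsubC subrr mulr0 mul0r //.
rewrite mulf_eq0 => /orP[] /eqP/evalX_eq0[A' eA].
  have [|u [A1 [B1 [u0 eA1 eG]]]] := IH c' A' B sc' c'0.
    by apply: (mulfI Xr0); rewrite mulrA -rmorphM [_ * c']mulrC -ec e eA mulrA.
  exists (('X - r%:P) * u), A1, B1; split=> //; first by rewrite mulf_neq0 // polyXsubC_eq0.
  by rewrite rmorphM /= eA eA1 mulrA.
have [|u [A1 [B1 [u0 eA1 eG]]]] := IH c' A A' sc' c'0.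
  by apply: (mulfI Xr0); rewrite mulrA -rmorphM [_ * c']mulrC -ec e eA mulrCA.
by exists u, A1, B1.
Qed.

Variables P Q : {poly C}.

(** The binary form of formal degree [k] with the coefficients of [F], evaluated at [P] and [Q]; the
    degree of [F] may be smaller. *)
Definition homog (k : nat) (F : {poly C}) : {poly C} :=
  \sum_(i < k.+1) F`_i *: (P ^+ i * Q ^+ (k - i)).

Definition lin (t : C * C) : {poly C} := t.1 *: P + t.2 *: Q.

Lemma homogS k F : (size F <= k.+1)%N -> homog k.+1 F = Q * homog k F.
Proof.
move=> hF; rewrite /homog big_ord_recr /= nth_default // scale0r addr0 mulr_sumr.
apply: eq_bigr => i _; rewrite -scalerAr mulrCA -exprS -subSn //.
by rewrite -ltnS.
Qed.

Lemma homogMX k F : homog k.+1 (F * 'X) = P * homog k F.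
Proof.
rewrite /homog big_ord_recl coefMX /= scale0r add0r mulr_sumr.
by apply: eq_bigr => i _; rewrite coefMX /= -scalerAr mulrA -exprS.
Qed.

Lemma homogD k F H : homog k (F + H) = homog k F + homog k H.
Proof. by rewrite /homog -big_split; apply: eq_bigr => i _; rewrite coefD scalerDl. Qed.

Lemma homogZ k c F : homog k (c *: F) = c *: homog k F.
Proof. by rewrite /homog scaler_sumr; apply: eq_bigr => i _; rewrite coefZ scalerA. Qed.

Lemma homog_lin k (t : C * C) F : (size F <= k.+1)%N ->
  homog k.+1 (F * (t.1 *: 'X + t.2%:P)) = lin t * homog k F.
Proof.
move=> hF; rewrite mulrDr -scalerAr [F * _%:P]mulrC mul_polyC homogD !homogZ homogMX homogS //.
by rewrite /lin mulrDl -!scalerAl.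
Qed.

Lemma prod_lin_homog (ts : seq (C * C)) :
  exists2 F : {poly C}, (size F <= (size ts).+1)%N & \prod_(t <- ts) lin t = homog (size ts) F.
Proof.
elim: ts => [|t ts [F hF e]].
  by exists 1; rewrite ?size_poly1 // big_nil /homog big_ord1 coef1 scale1r !expr0 mulr1.
exists (F * (t.1 *: 'X + t.2%:P)); last by rewrite big_cons e homog_lin.
rewrite (leq_trans (size_polyMleq _ _)) //=.
have : (size (t.1 *: 'X + t.2%:P)%R <= 2)%N.
  rewrite (leq_trans (size_polyD _ _)) // geq_max (leq_trans (size_scale_leq _ _)) ?size_polyX //.
  by rewrite (leq_trans (size_polyC_leq1 _)).
move=> h; rewrite -subn1 leq_subLR (leq_trans (leq_add hF h)) //.
by rewrite addn2 add1n.
Qed.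

Lemma homog_prod_lin k F : (size F <= k.+1)%N ->
  exists c (ts : seq (C * C)), size ts = k /\ homog k F = c *: \prod_(t <- ts) lin t.
Proof.
elim: k F => [|k IH] F hF.
  exists F`_0, [::]; split=> //.
  by rewrite big_nil /homog big_ord1 !expr0 mulr1.
case: (leqP (size F) k.+1) => hF'.
  have [c [ts [sts e]]] := IH F hF'.
  (* A drop in degree is a root at infinity, that is, a factor [Q]. *)
  exists c, ((0, 1) :: ts); rewrite /= sts; split=> //.
  by rewrite homogS // e big_cons /lin /= scale0r scale1r add0r scalerAr.
have /closed_rootP[r] : size F != 1%N by lia.
rewrite -dvdp_XsubCl => /dvdpP[F' eF].
have F'0 : F' != 0 by apply: contraTneq hF' => z; rewrite eF z mul0r size_poly0.
have [|c [ts [sts e]]] := IH F'.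
  by move: hF; rewrite eF size_mul_XsubC.
exists c, ((1, - r) :: ts); rewrite /= sts; split=> //.
pose t : C * C := (1, - r).
have -> : F = F' * (t.1 *: 'X + t.2%:P) by rewrite /= scale1r polyCN.
rewrite homog_lin; first by rewrite e big_cons scalerAr.
by move: hF; rewrite eF size_mul_XsubC.
Qed.

(** Binary forms of a given degree are closed under linear combinations, and over an algebraically
    closed field they split into linear forms. *)
Lemma comb_prod_lin (ts us : seq (C * C)) a b : size us = size ts ->
  exists c (vs : seq (C * C)), size vs = size ts /\
    a *: \prod_(t <- ts) lin t + b *: \prod_(t <- us) lin t = c *: \prod_(t <- vs) lin t.
Proof.
move=> e; have [F hF ->] := prod_lin_homog ts; have [H hH ->] := prod_lin_homog us.
rewrite e in hH *; rewrite -!homogZ -homogD; apply: homog_prod_lin.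
rewrite (leq_trans (size_polyD _ _)) // geq_max !(leq_trans (size_scale_leq _ _)) //.
Qed.

End Factoring.

(** * From tangent polygons to a pencil *)

Section Symmetric.
Variable C : numClosedFieldType.

Definition rational (f : C -> C) := rational_on_circle (fun z => (f z)%:P).

Lemma eq_rational (f h : C -> C) : (forall z, `|z| = 1 -> f z = h z) ->
  rational f -> rational h.
Proof. by move=> e; apply: rational_ext => z hz; rewrite e. Qed.

Lemma rational_add (f h : C -> C) : rational f -> rational h -> rational (fun z => f z + h z).
Proof. by move=> hf hh; apply: rational_ext (rationalD hf hh) => z _; rewrite rmorphD. Qed.

Lemma rational_sub (f h : C -> C) : rational f -> rational h -> rational (fun z => f z - h z).
Proof. by move=> hf hh; apply: rational_ext (rationalB hf hh) => z _; rewrite rmorphB. Qed.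

Lemma rational_mul (f h : C -> C) : rational f -> rational h -> rational (fun z => f z * h z).
Proof. by move=> hf hh; apply: rational_ext (rationalM hf hh) => z _; rewrite rmorphM. Qed.

Lemma rational_cst (c : C) : rational (fun=> c).
Proof. exact: rational_const. Qed.

Lemma horner_size3 (u : {poly C}) y : (size u <= 3)%N ->
  u.[y] = u`_0 + u`_1 * y + u`_2 * y ^+ 2.
Proof.
move=> h; rewrite (horner_coef_wide _ h) !big_ord_recl big_ord0 /= expr0 expr1 addr0 mulr1.
by rewrite /bump /= addrA.
Qed.

(** The expression is symmetric in [y z] and [y' z], hence a polynomial in their sum and product. *)
Lemma rational_symmetric (u v : {poly C}) (y y' : C -> C) :
  (size u <= 3)%N -> (size v <= 3)%N ->
  rational (fun z => y z + y' z) -> rational (fun z => y z * y' z) ->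
  rational (fun z => u.[y z] * v.[y' z] + u.[y' z] * v.[y z]).
Proof.
move=> hu hv hs hp; pose s z := y z + y' z; pose p z := y z * y' z.
apply: (@eq_rational (fun z =>
    2 * u`_0 * v`_0 + (u`_0 * v`_1 + u`_1 * v`_0) * s z
    + (u`_0 * v`_2 + u`_2 * v`_0) * (s z * s z - 2 * p z)
    + 2 * u`_1 * v`_1 * p z + (u`_1 * v`_2 + u`_2 * v`_1) * (p z * s z)
    + 2 * u`_2 * v`_2 * (p z * p z))).
  by move=> z _; rewrite !horner_size3 // /s /p; ring.
repeat (first [exact: rational_cst | exact: hs | exact: hp
  | apply: rational_sub | apply: rational_add | apply: rational_mul]).
Qed.

Lemma big_nat_mod (R : comPzRingType) (k m : nat) (f : nat -> R) :
  \prod_(0 <= i < k * m) f i = \prod_(0 <= r < k) \prod_(0 <= j < m) f (r + k * j)%N.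
Proof.
elim: m => [|m IH].
  by rewrite muln0 big_geq // big1 // => i _; rewrite big_geq.
under [RHS]eq_bigr do rewrite big_nat_recr //=.
rewrite big_split /= -IH (@big_cat_nat _ _ _ (k * m)%N) //=; last by rewrite leq_mul2l leqnSn orbT.
congr (_ * _); rewrite -{1}[(k * m)%N]add0n mulnS big_addn addnK.
by apply: eq_bigr.
Qed.

End Symmetric.

(* [num / den] is the Blaschke product and [x z 0 = z, x z 1, ...] runs cyclically through the
   vertices of the polygon through [z]; [q2], [q1], [q0] are the coefficients of the quadratic
   polynomial satisfied by the two neighbours of a vertex. *)
Section Cyclic.
Variable C : numClosedFieldType.
Variables (num den : {poly C}) (n : nat) (x : C -> nat -> C).
Variables (q2 q1 q0 : {poly C}).

(** Its roots on the circle are the points where [num / den] takes the same value as at [z]: the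
    vertices of the polygon through [z]. *)
Definition level (z : C) : {poly C} := den.[z] *: num - num.[z] *: den.

Hypothesis n2 : (2 < n)%N.
Hypothesis den_neq0 : forall z, `|z| = 1 -> den.[z] != 0.
Hypothesis x0 : forall z, `|z| = 1 -> x z 0 = z.
Hypothesis x_per : forall z i, `|z| = 1 -> x z (i + n) = x z i.
Hypothesis x_norm : forall z i, `|z| = 1 -> `|x z i| = 1.
Hypothesis x_inj : forall z i j, `|z| = 1 -> (i < n)%N -> (j < n)%N -> x z i = x z j -> i = j.
Hypothesis levelE : forall z, `|z| = 1 ->
  level z = (level z)`_n *: \prod_(0 <= i < n) ('X - (x z i)%:P).
Hypothesis level_lead : forall z, `|z| = 1 -> (level z)`_n != 0.
Hypothesis size_q : [/\ (size q2 <= 3)%N, (size q1 <= 3)%N & (size q0 <= 3)%N].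
Hypothesis q2_neq0 : forall z, `|z| = 1 -> q2.[z] != 0.
Hypothesis x_sum : forall z i, `|z| = 1 ->
  x z i + x z i.+2 = - (q1.[x z i.+1] / q2.[x z i.+1]).
Hypothesis x_prod : forall z i, `|z| = 1 ->
  x z i * x z i.+2 = q0.[x z i.+1] / q2.[x z i.+1].

Lemma x_perM z i j : `|z| = 1 -> x z (i + j * n) = x z i.
Proof.
by move=> hz; elim: j => [|j IH]; rewrite ?mul0n ?addn0 // mulSnr addnA x_per.
Qed.

Lemma x_mod z i : `|z| = 1 -> x z (i %% n) = x z i.
Proof. by move=> hz; rewrite [in RHS](divn_eq i n) addnC x_perM. Qed.

Lemma x_eqmod z i j : `|z| = 1 -> (x z i = x z j <-> i = j %[mod n]).
Proof.
move=> hz; split=> [|h]; last by rewrite -(x_mod i) // h x_mod.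
by rewrite -(x_mod i) // -(x_mod j) //; apply: x_inj; rewrite // ltn_pmod //; lia.
Qed.

(* The four neighbours of the vertices j steps away from z are the vertices j - 1 and j + 1 steps
   away from z. *)
Lemma rational_pair j : (j <= n)%N ->
  rational (fun z => x z j + x z (n - j)) /\ rational (fun z => x z j * x z (n - j)).
Proof.
have [s2 s1 s0] := size_q.
(* The recursion has three terms, so distances [i] and [i + 1] are carried together. *)
suff key i : (i.+1 <= n)%N ->
   (rational (fun z => x z i + x z (n - i)) /\ rational (fun z => x z i * x z (n - i))) /\
   (rational (fun z => x z i.+1 + x z (n - i.+1)) /\
    rational (fun z => x z i.+1 * x z (n - i.+1))).
  case: j => [|j] hj; last by have [] := key j hj.
  by have [] := key 0%N (ltnW (ltnW n2)).
have ratl_id : rational (fun z : C => z).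
  apply: (@eq_rational _ (fun z => 'X.[z])); last exact: rational_poly.
  by move=> z _; rewrite hornerX.
have inv (f : C -> C) : (forall z, `|z| = 1 -> f z != 0) -> rational f -> rational (fun z => (f z)^-1).
  exact: rationalV.
elim: i => [|i IH] hi.
  have xn z : `|z| = 1 -> x z n = z by move=> hz; rewrite -[n]add0n x_per // x0.
  have e1 z : `|z| = 1 -> x z (n - 1) + x z 1 = - (q1.[z] / q2.[z]).
    move=> hz; have := x_sum (n - 1) hz.
    have -> : (n - 1).+2 = (1 + n)%N by lia.
    have -> : (n - 1).+1 = n by lia.
    by rewrite x_per // xn.
  have e2 z : `|z| = 1 -> x z (n - 1) * x z 1 = q0.[z] / q2.[z].
    move=> hz; have := x_prod (n - 1) hz.
    have -> : (n - 1).+2 = (1 + n)%N by lia.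
    have -> : (n - 1).+1 = n by lia.
    by rewrite x_per // xn.
  split; split.
  - apply: (@eq_rational _ (fun z => z + z)); last exact: rational_add.
    by move=> z hz; rewrite subn0 xn // x0.
  - apply: (@eq_rational _ (fun z => z * z)); last exact: rational_mul.
    by move=> z hz; rewrite subn0 xn // x0.
  - apply: (@eq_rational _ (fun z => 0 - (q1.[z] * q2.[z]^-1))).
      by move=> z hz; rewrite sub0r [RHS]addrC e1.
    apply: rational_sub; first exact: rational_cst.
    by apply: rational_mul; [exact: rational_poly | apply: inv => //; exact: rational_poly].
  - apply: (@eq_rational _ (fun z => q0.[z] * q2.[z]^-1)).
      by move=> z hz; rewrite [RHS]mulrC e2.
    by apply: rational_mul; [exact: rational_poly | apply: inv => //; exact: rational_poly].
have [[hs hp] [hs' hp']] := IH (ltnW hi); split=> //.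
pose y z := x z i.+1; pose y' z := x z (n - i.+1).
have half (u v : {poly C}) : (size u <= 3)%N -> (size v <= 3)%N ->
    rational (fun z => u.[y z] * v.[y' z] + u.[y' z] * v.[y z]).
  by move=> hu hv; apply: rational_symmetric.
have diag (u : {poly C}) : (size u <= 3)%N -> rational (fun z => u.[y z] * u.[y' z]).
  move=> hu; apply: (@eq_rational _ (fun z => 2^-1 * (u.[y z] * u.[y' z] + u.[y' z] * u.[y z]))).
    by move=> z _; field.
  by apply: rational_mul; [exact: rational_cst | exact: half].
have yn z : `|z| = 1 -> q2.[y z] != 0 by move=> hz; rewrite q2_neq0 ?x_norm.
have yn' z : `|z| = 1 -> q2.[y' z] != 0 by move=> hz; rewrite q2_neq0 ?x_norm.
have hM : rational (fun z => (q2.[y z] * q2.[y' z])^-1).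
  by apply: inv; [move=> z hz; rewrite mulf_neq0 ?yn ?yn' | exact: diag].
have i2 : (n - i.+2).+2 = (n - i)%N by lia.
have i1 : (n - i.+2).+1 = (n - i.+1)%N by lia.
have es z : `|z| = 1 -> x z i.+2 + x z (n - i.+2) =
   0 - (q1.[y z] * q2.[y' z] + q1.[y' z] * q2.[y z]) * (q2.[y z] * q2.[y' z])^-1
   - (x z i + x z (n - i)).
  move=> hz; have h := x_sum i hz; have := x_sum (n - i.+2) hz; rewrite i2 i1 => h'.
  have -> : x z i.+2 + x z (n - i.+2) = (x z i + x z i.+2) + (x z (n - i.+2) + x z (n - i))
      - (x z i + x z (n - i)) by ring.
  by rewrite h h' -/(y z) -/(y' z); field; rewrite yn ?yn'.
have hs2 : rational (fun z => x z i.+2 + x z (n - i.+2)).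
  apply: eq_rational (fun z hz => esym (es z hz)) _.
  apply: rational_sub => //; apply: rational_sub; first exact: rational_cst.
  by apply: rational_mul => //; apply: half.
split=> //.
apply: (@eq_rational _ (fun z =>
   (q0.[y z] * q2.[y' z] + q0.[y' z] * q2.[y z]) * (q2.[y z] * q2.[y' z])^-1
   + (q1.[y z] * q1.[y' z]) * (q2.[y z] * q2.[y' z])^-1
   - x z i * x z (n - i) - (x z i + x z (n - i)) * (x z i.+2 + x z (n - i.+2)))).
  move=> z hz; have h := x_sum i hz; have := x_sum (n - i.+2) hz; rewrite i2 i1 => h'.
  have k := x_prod i hz; have := x_prod (n - i.+2) hz; rewrite i2 i1 => k'.
  (* The second elementary symmetric function of the four neighbours is computed in two ways:
     pairing those of the same vertex, and pairing those at the same distance from [z]. *)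
  have -> : x z i.+2 * x z (n - i.+2) = x z i * x z i.+2 + x z (n - i.+2) * x z (n - i)
     + (x z i + x z i.+2) * (x z (n - i.+2) + x z (n - i))
     - x z i * x z (n - i) - (x z i + x z (n - i)) * (x z i.+2 + x z (n - i.+2)) by ring.
  by rewrite h h' k k' -/(y z) -/(y' z); field; rewrite yn ?yn'.
apply: rational_sub; last exact: rational_mul.
apply: rational_sub => //; apply: rational_add; apply: rational_mul => //; [exact: half|exact: diag].
Qed.

(** The factors at [i] and [n - i] multiply to a quadratic whose coefficients are given by
    [rational_pair]; a middle vertex is half the sum of its pair. *)
Lemma rational_level_prod (S : pred nat) :
  (forall i, (0 < i < n)%N -> S (n - i)%N = S i) ->
  rational_on_circle (fun z => \prod_(0 <= i < n) (if S i then 'X - (x z i)%:P else 1)).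
Proof.
move=> hS.
apply: (rational_paired_prod (f := fun i z => if S i then 'X - (x z i)%:P else 1)).
- case: (S 0%N); last exact: rational_const.
  apply: (@rational_ext _ (fun z => 'X - 'X.[z]%:P)).
    by move=> z hz; rewrite hornerX x0.
  by apply: rationalB; [exact: rational_const | exact: rational_poly].
- move=> i hi; rewrite hS //; case: (S i); last first.
    by apply: rational_ext (rational_const 1) => z _; rewrite mulr1.
  have [|hs hp] := @rational_pair i; first by lia.
  apply: (@rational_ext _ (fun z => 'X ^+ 2 - (x z i + x z (n - i))%:P * 'X
       + (x z i * x z (n - i))%:P)).
    by move=> z hz; rewrite rmorphD rmorphM /=; ring.
  apply: rationalD => //; apply: rationalB; first exact: rational_const.
  by apply: rationalM => //; exact: rational_const.
- move=> i hi; case: (S i); last exact: rational_const.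
  have [|hs hp] := @rational_pair i; first by lia.
  apply: rationalB; first exact: rational_const.
  apply: (@eq_rational _ (fun z => 2^-1 * (x z i + x z (n - i)))).
    have -> : (n - i)%N = i by lia.
    by move=> z _; field.
  by apply: rational_mul => //; exact: rational_cst.
Qed.

(* Two consecutive points determine the rest of the cycle, so the enumeration of the level set
   from another starting point agrees with the given one up to orientation. *)
Lemma x_shift z i : `|z| = 1 ->
  (forall j, x (x z i) j = x z (i + j)) \/ (forall j, x (x z i) j = x z (i + (n - 1) * j)).
Proof.
move=> hz; set y := x z i; have hy : `|y| = 1 by exact: x_norm.
have rec (a b : nat -> C) :
    (forall j, a j + a j.+2 = - (q1.[a j.+1] / q2.[a j.+1])) ->
    (forall j, b j + b j.+2 = - (q1.[b j.+1] / q2.[b j.+1])) ->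
    a 0%N = b 0%N -> a 1%N = b 1%N -> forall j, a j = b j.
  move=> ha hb e0 e1; suff h j : a j = b j /\ a j.+1 = b j.+1 by move=> j; have [] := h j.
  elim: j => // j [h0 h1]; split=> //.
  by apply: (@addrI _ (a j)); rewrite ha h1 -hb h0.
have ry j := x_sum j hy.
have rf j : x z (i + j) + x z (i + j.+2) = - (q1.[x z (i + j.+1)] / q2.[x z (i + j.+1)]).
  by rewrite !addnS x_sum.
have rb j : x z (i + (n - 1) * j) + x z (i + (n - 1) * j.+2) =
    - (q1.[x z (i + (n - 1) * j.+1)] / q2.[x z (i + (n - 1) * j.+1)]).
  (* Going [n - 1] steps forward is going one step back, so [x_sum] at [c] is the recursion read
     backwards. *)
  set c := (i + (n - 1) * j.+1 + (n - 1))%N.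
  have <- : x z c.+1 = x z (i + (n - 1) * j.+1).
    by rewrite -(x_per (i + (n - 1) * j.+1) hz); congr (x z _); rewrite /c; lia.
  have -> : x z (i + (n - 1) * j) = x z c.+2.
    by rewrite -(x_perM (i + (n - 1) * j) 2 hz); congr (x z _); rewrite /c; lia.
  by rewrite -x_sum // addrC; congr (x z _ + _); rewrite /c; lia.
have y1 : x y 1 = x z (i + 1) \/ x y 1 = x z (i + (n - 1) * 1).
  have s1 := x_sum (n - 1) hy; have p1 := x_prod (n - 1) hy.
  have s2 := x_sum (i + (n - 1)) hz; have p2 := x_prod (i + (n - 1)) hz.
  have e1 : (n - 1).+2 = (1 + n)%N by lia.
  have e2 : (n - 1).+1 = (0 + n)%N by lia.
  have e3 : (i + (n - 1)).+2 = (i + 1 + n)%N by lia.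
  have e4 : (i + (n - 1)).+1 = (i + n)%N by lia.
  rewrite e1 e2 !x_per // x0 // in s1 p1; rewrite e3 e4 !x_per // -/y in s2 p2.
  rewrite -s1 -p1 muln1 in s2 p2 *.
  (* The successor of [y] in its own cycle is a root of the quadratic at [y], whose roots are the
     two neighbours of [y] in the cycle of [z]. *)
  have : (x y 1 - x z (i + 1)) * (x y 1 - x z (i + (n - 1))) == 0.
    apply/eqP; have -> : (x y 1 - x z (i + 1)) * (x y 1 - x z (i + (n - 1))) =
      x y 1 ^+ 2 - (x z (i + (n - 1)) + x z (i + 1)) * x y 1
        + x z (i + (n - 1)) * x z (i + 1) by ring.
    by rewrite s2 p2; ring.
  by rewrite mulf_eq0 !subr_eq0 => /orP[] /eqP; [left|right].
have y0 : x y 0 = x z i by rewrite x0.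
case: y1 => y1; [left|right]; apply: rec => //.
- by rewrite addn0.
- by rewrite muln0 addn0.
Qed.

(** * Orbits of every [k]-th vertex, and the factor of the level polynomial that they define *)

Variables k m : nat.
Hypothesis nkm : n = (k * m)%N.

Let n0 : (0 < n)%N. Proof. by lia. Qed.
Let k0 : (0 < k)%N. Proof. by move: nkm n2; case: k => //; lia. Qed.
Let m0 : (0 < m)%N. Proof. by move: nkm n2; case: m => //; rewrite muln0; lia. Qed.

Definition orb (z : C) : seq C := [seq x z (k * j) | j <- iota 0 m].

Definition Phi (z : C) : {poly C} := \prod_(y <- orb z) ('X - y%:P).

Lemma size_orb z : size (orb z) = m.
Proof. by rewrite size_map size_iota. Qed.

Lemma mem_orb z v : `|z| = 1 -> (v \in orb z) <-> exists j, v = x z (k * j).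
Proof.
move=> hz; split=> [/mapP[j _ ->]|[j ->]]; first by exists j.
apply/mapP; exists (j %% m)%N; first by rewrite mem_iota /= ltn_pmod.
by apply/x_eqmod => //; rewrite nkm -!muln_modr modn_mod.
Qed.

Lemma uniq_orb_shift z r : `|z| = 1 -> uniq [seq x z (r + k * j) | j <- iota 0 m].
Proof.
move=> hz; rewrite map_inj_in_uniq ?iota_uniq // => i j.
rewrite !mem_iota /= => hi hj /(x_eqmod _ _ hz) /eqP.
rewrite eqn_modDl nkm -!muln_modr eqn_pmul2l // !modn_small //; exact: eqP.
Qed.

(** The orientation of the cycle of [x z i] does not matter: [j] steps back are [(n - 1) * j] steps
    forward, so both directions meet the same vertices. *)
Lemma mem_orb_shift z i v : `|z| = 1 ->
  (v \in orb (x z i)) <-> exists j, v = x z (i + k * j).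
Proof.
move=> hz; have hy := x_norm i hz.
apply: (iff_trans (mem_orb v hy)); have [h|h] := x_shift i hz.
  by split=> -[j ->]; exists j; rewrite h.
split=> -[j ->].
  by exists ((n - 1) * j)%N; rewrite h mulnCA.
exists ((n - 1) * j)%N; rewrite h.
rewrite -(x_perM (i + k * j) ((n - 2) * (k * j)) hz); congr (x z _).
have -> : n = (n - 2).+2 by lia.
move: (n - 2)%N => p; rewrite subn1 subn2 /=; lia.
Qed.

Lemma perm_orb_shift z i : `|z| = 1 ->
  perm_eq (orb (x z i)) [seq x z (i + k * j) | j <- iota 0 m].
Proof.
move=> hz; apply: uniq_perm; [exact: (uniq_orb_shift 0 (x_norm i hz))|exact: uniq_orb_shift|].
move=> v; apply/idP/idP => [/(mem_orb_shift _ _ hz)[j ->]|/mapP[j _ ->]]; last first.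
  by apply/mem_orb_shift => //; exists j.
apply/mapP; exists (j %% m)%N; first by rewrite mem_iota /= ltn_pmod.
by apply/x_eqmod => //; apply/eqP; rewrite eqn_modDl nkm -!muln_modr modn_mod.
Qed.

Lemma Phi_shift z i : `|z| = 1 ->
  Phi (x z i) = \prod_(0 <= j < m) ('X - (x z (i + k * j))%:P).
Proof.
move=> hz; rewrite /Phi (perm_big _ (perm_orb_shift i hz)) big_map.
by rewrite /index_iota subn0.
Qed.

Lemma Phi_orb z y : `|z| = 1 -> y \in orb z -> Phi y = Phi z.
Proof.
move=> hz /(mem_orb _ hz)[i ->].
apply: perm_big; apply: uniq_perm; rewrite ?(uniq_orb_shift 0) ?x_norm //.
move=> v; apply/idP/idP => [/(mem_orb_shift _ _ hz)[j ->]|/(mem_orb _ hz)[j ->]].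
  by apply/mem_orb => //; exists (i + j)%N; rewrite mulnDr.
(* The index [k * i + k * (j + i * (m - 1))] is [k * j] plus [i] full turns. *)
apply/mem_orb_shift => //; exists (j + i * (m - 1))%N.
rewrite -(x_perM (k * j) i hz); congr (x z _); rewrite nkm.
have -> : m = (m - 1).+1 by lia.
by move: (m - 1)%N => p; rewrite subn1 /=; lia.
Qed.

Lemma orb_sym z i : `|z| = 1 -> (z \in orb (x z i)) = (x z i \in orb z).
Proof.
move=> hz; apply/idP/idP.
  move/(mem_orb_shift _ _ hz) => [j e].
  have {}e : x z 0 = x z (i + k * j) by rewrite x0.
  have /eqP : 0 = i + k * j %[mod n] by apply/(x_eqmod _ _ hz).
  rewrite mod0n eq_sym => hd.
  have : (k %| i + k * j)%N by apply: dvdn_trans hd; rewrite nkm dvdn_mulr.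
  rewrite dvdn_addl ?dvdn_mulr // => /dvdnP[i' ->].
  by apply/mem_orb => //; exists i'; rewrite mulnC.
move=> h; have [hy hz0] := (x_norm i hz, x0 hz).
have : z \in orb z by apply/mem_orb => //; exists 0%N; rewrite muln0 x0.
by rewrite -!(root_prod_XsubC (orb _)) -!/(Phi _) (Phi_orb hz h).
Qed.

Lemma level_factor z : `|z| = 1 ->
  level z = (level z)`_n *: \prod_(0 <= r < k) Phi (x z r).
Proof.
move=> hz; rewrite {1}levelE //; congr (_ *: _).
rewrite nkm big_nat_mod; apply: eq_bigr => r _; by rewrite Phi_shift.
Qed.

(** This is [N(Y) M(X) - N(X) M(Y)]. Setting [X] to [z] gives [level z]; setting [Y] to [w] gives
    [- level w]. *)
Definition bilevel : {poly {poly C}} :=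
  den%:P * map_poly polyC num - num%:P * map_poly polyC den.

Lemma evalX_map_polyC z (p : {poly C}) : evalX z (map_poly polyC p) = p.
Proof. by apply/polyP => i; rewrite coef_evalX coef_map /= hornerC. Qed.

Lemma evalX_bilevel z : evalX z bilevel = level z.
Proof. by rewrite evalXB !evalXM !evalXC !evalX_map_polyC !mul_polyC. Qed.

Lemma horner_evalX z w (A : {poly {poly C}}) : (evalX z A).[w] = A.[w%:P].[z].
Proof.
by rewrite /evalX -[w in LHS](hornerC w z) -[in LHS](horner_evalE z w%:P) horner_map.
Qed.

Lemma level_antisym z w : (level z).[w] = - (level w).[z].
Proof. by rewrite !hornerE; ring. Qed.

(** The products over the multiples of [k] and over the other indices are both rational. Their
    numerators factor [bilevel] up to a polynomial in [X], which [gauss_content] removes; [bad]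
    gathers the denominator and the removed content. *)
Lemma bilevel_factor : exists (A B : {poly {poly C}}) (bad : {poly C}),
  [/\ bad != 0, bilevel = A * B &
   forall z, `|z| = 1 -> bad.[z] != 0 -> exists2 b, b != 0 & evalX z A = b *: Phi z].
Proof.
have hS i : (0 < i < n)%N -> (k %| n - i)%N = (k %| i)%N.
  by move=> hi; rewrite dvdn_subr ?nkm ?dvdn_mulr // -nkm; lia.
have [c1 [A [c10 hA]]] := rational_level_prod hS.
have [i hi|c2 [B [c20 hB]]] := @rational_level_prod (fun i => ~~ (k %| i)%N).
  by rewrite hS.
have PhiE z : `|z| = 1 ->
    Phi z = \prod_(0 <= i < n) (if (k %| i)%N then 'X - (x z i)%:P else 1).
  move=> hz; rewrite nkm big_nat_mod big_ltn // [X in _ * X]big1_seq ?mulr1.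
    rewrite -[in LHS](x0 hz) Phi_shift //; apply: eq_bigr => j _.
    by rewrite add0n dvdn_mulr.
  move=> r /andP[_]; rewrite mem_index_iota => /andP[r1 r2].
  rewrite big1 // => j _; rewrite dvdn_addl ?dvdn_mulr // gtnNdvd //.
have e : (c1 * c2)%:P * bilevel = A * ((bilevel`_n)%:P * B).
  apply: eq_evalX_circle => z hz; rewrite !evalXM !evalXC evalX_bilevel.
  rewrite -hA // -hB // -coef_evalX evalX_bilevel {1}levelE // !mul_polyC.
  rewrite -!scalerAl -!scalerAr !scalerA hornerM -big_split /=.
  congr (_ *: _); first by ring.
  by apply: eq_bigr => i _; case: (k %| i)%N; rewrite ?mul1r ?mulr1.
have [u [A1 [B1 [u0 eA eG]]]] := gauss_content (mulf_neq0 c10 c20) e.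
exists A1, B1, (c1 * u); split=> //; first by rewrite mulf_neq0.
move=> z hz; rewrite hornerM mulf_eq0 negb_or => /andP[c1z uz].
exists (u.[z]^-1 * c1.[z]); first by rewrite mulf_neq0 ?invr_eq0.
by rewrite PhiE // -scalerA hA // eA evalXM evalXC mul_polyC scalerA mulVf // scale1r.
Qed.

Lemma level_root z w : `|z| = 1 -> `|w| = 1 ->
  root (level z) w <-> num.[z] / den.[z] = num.[w] / den.[w].
Proof.
move=> hz hw; rewrite /root !hornerE subr_eq0.
split=> [/eqP h|/eqP]; first by apply/eqP; rewrite eqr_div ?den_neq0 // -h mulrC.
by rewrite eqr_div ?den_neq0 // => /eqP ->; rewrite mulrC.
Qed.

Lemma level_rootP z w : `|z| = 1 -> root (level z) w <-> exists i, w = x z i.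
Proof.
move=> hz; rewrite levelE // rootZ ?level_lead //.
rewrite -(big_map (x z) predT (fun y => 'X - y%:P)) root_prod_XsubC.
split=> [/mapP[i _ ->]|[i ->]]; first by exists i.
apply/mapP; exists (i %% n)%N; last by rewrite x_mod.
by rewrite mem_index_iota ltn_pmod.
Qed.

Lemma level_neq0 z : `|z| = 1 -> level z != 0.
Proof. by move=> hz; apply: contraNneq (level_lead hz) => ->; rewrite coef0. Qed.

(** A polygon with a root [b] of [bad] as a vertex is the polygon of [b], so it suffices to keep [w]
    off the roots of [level b] for the finitely many such [b] on the circle. *)
Lemma exists_good_level (bad p : {poly C}) : bad != 0 -> p != 0 ->
  exists w, [/\ `|w| = 1, p.[w] != 0 & forall i, bad.[x w i] != 0].
Proof.
move=> b0 p0; have [rs ers] := closed_field_poly_normal bad.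
pose h := p * \prod_(b <- rs | `|b| == 1) level b.
have h0 : h != 0.
  rewrite mulf_neq0 // prodf_seq_neq0; apply/allP => b _; apply/implyP => /eqP hb.
  exact: level_neq0.
have [w hw] := circle_not_root h0.
rewrite hornerM mulf_eq0 negb_or => /andP[pw]; rewrite horner_prod => hb.
exists w; split=> // i; apply/negP => badi.
have hxi := x_norm i hw.
have xin : x w i \in rs.
  by move: badi; rewrite -/(root bad _) ers rootZ ?lead_coef_eq0 // root_prod_XsubC.
move: hb; rewrite prodf_seq_neq0 => /allP /(_ _ xin); rewrite hxi eqxx /=.
rewrite level_antisym oppr_eq0 -/(root _ _) => /negP; apply.
by apply/level_rootP => //; exists i.
Qed.

Lemma root_Phi z v : root (Phi z) v = (v \in orb z).
Proof. exact: root_prod_XsubC. Qed.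

(* The slice A(X, w) divides the squarefree polynomial [- level w] and vanishes at x_i exactly
   when w lies in the orbit of x_i, that is when x_i lies in the orbit of w. *)
Lemma slice_eq (A B : {poly {poly C}}) (bad : {poly C}) w :
  bilevel = A * B ->
  (forall z, `|z| = 1 -> bad.[z] != 0 -> exists2 b, b != 0 & evalX z A = b *: Phi z) ->
  `|w| = 1 -> (forall i, bad.[x w i] != 0) ->
  exists2 c, c != 0 & A.[w%:P] = c *: Phi w.
Proof.
move=> eG hA hw good.
have slice_root i : root A.[w%:P] (x w i) = (x w i \in orb w).
  have [b b0 e] := hA _ (x_norm i hw) (good i).
  by rewrite /root -horner_evalX e -/(root _ _) rootZ // root_Phi orb_sym.
have eL : A.[w%:P] * B.[w%:P] = - level w.
  apply: eq_on_circle => z hz.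
  by rewrite -hornerM -horner_evalX -eG evalX_bilevel level_antisym hornerN.
pose s := [seq x w i | i <- iota 0 n].
have us : uniq s.
  rewrite map_inj_in_uniq ?iota_uniq // => i j; rewrite !mem_iota /= => hi hj.
  exact: x_inj.
have dv : A.[w%:P] %| \prod_(y <- s) ('X - y%:P).
  have : A.[w%:P] %| level w by rewrite -dvdpNr -eL dvdp_mulr.
  by rewrite levelE // dvdpZr ?level_lead // -(big_map (x w) predT (fun y => 'X - y%:P))
    /index_iota subn0.
have [mm emm] := dvdp_prod_XsubC dv.
have pm : perm_eq (mask mm s) (orb w).
  apply: uniq_perm; rewrite ?mask_uniq //.
    by rewrite -[w](x0 hw); have := perm_uniq (perm_orb_shift 0 hw); rewrite uniq_orb_shift.
  move=> v; rewrite -(root_prod_XsubC (mask mm s)) -(eqp_root emm).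
  apply/idP/idP => [h|h].
    have : root (\prod_(y <- s) ('X - y%:P)) v by move: h; rewrite -!dvdp_XsubCl => h; apply: dvdp_trans h dv.
    by rewrite root_prod_XsubC => /mapP[i _ ev]; move: h; rewrite ev slice_root.
  by have /(mem_orb _ hw)[j ev] := h; move: h; rewrite ev -slice_root.
have e := eqpfP emm; rewrite (perm_big _ pm) in e.
exists (lead_coef A.[w%:P] / lead_coef (Phi w)); last exact: e.
rewrite mulf_neq0 ?invr_eq0 ?lead_coef_eq0 //; last by rewrite monic_neq0 ?monic_prod_XsubC.
by apply: contraTneq (level_neq0 hw) => h; rewrite negbK -oppr_eq0 -eL h mul0r.
Qed.

Definition circle_rooted (p : {poly C}) : Prop :=
  exists (c : C) (rs : seq C), [/\ c != 0, size rs = m, forall y, y \in rs -> `|y| = 1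
    & p = c *: \prod_(y <- rs) ('X - y%:P)].

(** The pencil is spanned by the slices of [A] at points [w0], [w1] of two different polygons. The
    levels of [w0] and [w1] are products of [k] of its members, and [num] is a combination of these
    levels, to which [comb_prod_lin] applies. *)
Lemma num_pencil : exists (P Q : {poly C}) (c : C) (ts : seq (C * C)),
  [/\ circle_rooted P, circle_rooted Q, size ts = k & num = c *: \prod_(t <- ts) lin P Q t].
Proof.
have [A [B [bad [bad0 eG hA]]]] := bilevel_factor.
have [w0 [hw0 _ good0]] := exists_good_level bad0 (oner_neq0 _).
have [w1 [hw1 lw01 good1]] := exists_good_level bad0 (level_neq0 hw0).
have [c0 c00 eP] := slice_eq eG hA hw0 good0.
have [c1 c10 eQ] := slice_eq eG hA hw1 good1.
set P := A.[w0%:P] in eP; set Q := A.[w1%:P] in eQ.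
have Pv u : P.[u] = (evalX u A).[w0] by rewrite horner_evalX.
have Qv u : Q.[u] = (evalX u A).[w1] by rewrite horner_evalX.
have orb_norm w y : `|w| = 1 -> y \in orb w -> `|y| = 1.
  by move=> hw /(mem_orb _ hw)[j ->]; apply: x_norm.
have orb_level w y : `|w| = 1 -> y \in orb w -> root (level w) y.
  by move=> hw /(mem_orb _ hw)[j ->]; apply/level_rootP => //; exists (k * j)%N.
have B01 : num.[w0] / den.[w0] <> num.[w1] / den.[w1].
  by move=> h; move/negP: lw01; apply; apply/level_root.
have Q_level y : `|y| = 1 -> root (level w0) y -> Q.[y] != 0.
  move=> hy h; rewrite -/(root _ _) eQ rootZ // root_Phi; apply/negP => /(orb_level _ _ hw1).
  by move/(level_root hw1 hy) => e; apply: B01; rewrite e; apply/level_root.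
have P_level y : `|y| = 1 -> root (level w1) y -> P.[y] != 0.
  move=> hy h; rewrite -/(root _ _) eP rootZ // root_Phi; apply/negP => /(orb_level _ _ hw0).
  by move/(level_root hw0 hy) => e; apply: B01; rewrite e; apply/esym/level_root.
have w_orb w : `|w| = 1 -> w \in orb w.
  by move=> hw; apply/mem_orb => //; exists 0%N; rewrite muln0 x0.
have sz w c : c != 0 -> size (c *: Phi w) = m.+1.
  by move=> c0'; rewrite size_scale // size_prod_XsubC size_orb.
have uorb w : `|w| = 1 -> uniq (orb w).
  by move=> hw; have := uniq_orb_shift 0 hw.
(* Q(z) P - P(z) Q vanishes on the orbit of z because P(y) / Q(y) is the ratio of the values of
   Phi_y = Phi_z at w0 and w1. *)
have pencilE z : `|z| = 1 -> (forall i, bad.[x z i] != 0) -> (P.[z] != 0) || (Q.[z] != 0) ->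
    exists t : C * C, Phi z = lin P Q t.
  move=> hz good nz; pose t := (Q.[z], - P.[z]); pose L := lin P Q t.
  have L_root y : y \in orb z -> root L y.
    move=> hy; have /(mem_orb _ hz)[j ey] := hy.
    have [|b b0 e] := hA _ (orb_norm _ _ hz hy); first by rewrite ey.
    have [|b' b'0 e'] := hA _ hz; first by rewrite -(x0 hz).
    rewrite (Phi_orb hz hy) in e.
    rewrite /root /L /lin /= hornerD !hornerZ !Pv !Qv e e' !hornerZ.
    by apply/eqP; ring.
  (* Since [P] vanishes at [w0] and [Q] at [w1], the values of [L] there are [- P.[z] * Q.[w0]] and
     [Q.[z] * P.[w1]], which are not both zero. *)
  have L0 : L != 0.
    apply: contraTneq nz => e.
    have : L.[w0] = 0 by rewrite e horner0.
    have : L.[w1] = 0 by rewrite e horner0.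
    have P0 : P.[w0] = 0 by apply/rootP; rewrite eP rootZ // root_Phi w_orb.
    have Q0 : Q.[w1] = 0 by apply/rootP; rewrite eQ rootZ // root_Phi w_orb.
    have P1 : P.[w1] != 0 by apply: P_level => //; apply: orb_level; rewrite ?w_orb.
    have Q1 : Q.[w0] != 0 by apply: Q_level => //; apply: orb_level; rewrite ?w_orb.
    rewrite /L /lin /= !hornerE P0 Q0 !mulr0 addr0 add0r => /eqP.
    rewrite mulf_eq0 (negbTE P1) orbF => /eqP -> /eqP.
    by rewrite mulf_eq0 (negbTE Q1) orbF oppr_eq0 eqxx orbF => ->.
  have aL : all (root L) (orb z) by apply/allP.
  (* Degree at most [m] and [m] distinct roots: [L] is a scalar multiple of [Phi z]. *)
  have sL : size L = (size (orb z)).+1.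
    apply/eqP; rewrite eqn_leq (max_poly_roots L0 aL (uorb _ hz)) andbT size_orb.
    rewrite (leq_trans (size_polyD _ _)) // geq_max !(leq_trans (size_scale_leq _ _)) //.
      by rewrite eQ sz.
    by rewrite eP sz.
  have := all_roots_prod_XsubC sL aL; rewrite uniq_rootsE => /(_ (uorb _ hz)).
  rewrite -/(Phi z) => e; set l := lead_coef L in e.
  have l0 : l != 0 by rewrite lead_coef_eq0.
  exists (l^-1 * t.1, l^-1 * t.2).
  by rewrite /lin /= -!scalerA -scalerDr -/(lin P Q t) -/L e scalerA mulVf // scale1r.
have level_lin w : `|w| = 1 -> (forall i, bad.[x w i] != 0) ->
    (forall i, (P.[x w i] != 0) || (Q.[x w i] != 0)) ->
    exists2 ts, size ts = k & level w = (level w)`_n *: \prod_(t <- ts) lin P Q t.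
  move=> hw good nz.
  have ex i : exists t : C * C, Phi (x w i) == lin P Q t.
    have [|t e] := pencilE _ (x_norm i hw) _ (nz i); last by exists t; rewrite e.
    by move=> j; have [->|->] := x_shift i hw.
  exists [seq xchoose (ex i) | i <- iota 0 k]; first by rewrite size_map size_iota.
  rewrite {1}level_factor // big_map /index_iota subn0; congr (_ *: _).
  by apply: eq_bigr => i _; apply/eqP; apply: (xchooseP (ex i)).
(* Distinct polygons share no vertex, so [Q] has no zero on the polygon of [w0], nor [P] on that of
   [w1]. *)
have [i|ts0 s0 e0] := level_lin _ hw0 good0.
  by rewrite Q_level ?orbT ?x_norm //; apply/level_rootP => //; exists i.
have [i|ts1 s1 e1] := level_lin _ hw1 good1.
  by rewrite P_level ?x_norm //; apply/level_rootP => //; exists i.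
pose d := den.[w0] * num.[w1] - num.[w0] * den.[w1].
have d0 : d != 0.
  apply/negP; rewrite subr_eq0 => /eqP h; apply: B01; apply/eqP.
  by rewrite eqr_div ?den_neq0 // -h mulrC.
(* Cramer's rule, with determinant [d]. *)
have eN : num = (d^-1 * num.[w1]) *: level w0 + (- (d^-1 * num.[w0])) *: level w1.
  rewrite /level !scalerBr !scalerA addrACA -scalerDl -opprD -scalerDl.
  have -> : d^-1 * num.[w1] * den.[w0] + - (d^-1 * num.[w0]) * den.[w1] = 1.
    by rewrite -[RHS](mulVf d0) /d; ring.
  have -> : d^-1 * num.[w1] * num.[w0] + - (d^-1 * num.[w0]) * num.[w1] = 0 by ring.
  by rewrite scale1r scale0r subr0.
have [c [ts [sts e]]] := comb_prod_lin P Q (d^-1 * num.[w1] * (level w0)`_n)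
  (- (d^-1 * num.[w0]) * (level w1)`_n) (etrans s1 (esym s0)).
exists P, Q, c, ts; split.
- by exists c0, (orb w0); rewrite size_orb; split=> // y; apply: orb_norm.
- by exists c1, (orb w1); rewrite size_orb; split=> // y; apply: orb_norm.
- by rewrite sts.
- by rewrite -e -!scalerA -e0 -e1 scalerA.
Qed.

End Cyclic.

(** * From the pencil to Blaschke products *)

Section BlaschkeFraction.
Variable C : numClosedFieldType.
Implicit Types (z a : C) (s : seq C).

Definition bnum s : {poly C} := \prod_(a <- s) ('X - a%:P).
Definition bden s : {poly C} := \prod_(a <- s) (1 - a^* *: 'X).
Definition in_disk s := forall a, a \in s -> `|a| < 1.

Lemma bnumE s z : (bnum s).[z] = \prod_(a <- s) (z - a).
Proof. by rewrite horner_prod; apply: eq_bigr => a _; rewrite !hornerE. Qed.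

Lemma bdenE s z : (bden s).[z] = \prod_(a <- s) (1 - a^* * z).
Proof. by rewrite horner_prod; apply: eq_bigr => a _; rewrite !hornerE. Qed.

(** For [a] in the disk the sign of the right side depends only on the position of [z] relative to
    the circle; all comparisons of numerator and denominator rest on this. *)
Lemma normB_factor z a :
  `|1 - a^* * z| ^+ 2 - `|z - a| ^+ 2 = (1 - `|z| ^+ 2) * (1 - `|a| ^+ 2).
Proof. by rewrite !normCK !rmorphB !rmorphM /= rmorph1 conjCK; ring. Qed.

Lemma disk_factor a : `|a| < 1 -> 0 < 1 - `|a| ^+ 2.
Proof. by move=> h; rewrite subr_gt0 expr_lt1. Qed.

Lemma factor_lt z a : `|a| < 1 -> `|z| < 1 -> `|z - a| < `|1 - a^* * z|.
Proof.
move=> ha hz; rewrite -(@ltr_pXn2r _ 2) ?nnegrE // -subr_gt0 normB_factor.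
by rewrite mulr_gt0 ?disk_factor.
Qed.

Lemma factor_gt z a : `|a| < 1 -> 1 < `|z| -> `|1 - a^* * z| < `|z - a|.
Proof.
move=> ha hz; rewrite -(@ltr_pXn2r _ 2) ?nnegrE // -subr_gt0 -opprB normB_factor.
by rewrite -mulNr opprB mulr_gt0 ?disk_factor // subr_gt0 expr_gt1.
Qed.

Lemma prod_norm_lt s (f h : C -> C) : s != [::] ->
  (forall a, a \in s -> `|f a| < `|h a|) ->
  `|\prod_(a <- s) f a| < `|\prod_(a <- s) h a|.
Proof.
case: s => // a s _; elim: s a => [|b s IH] a H; first by rewrite !big_seq1 H ?inE.
rewrite !(big_cons _ _ a) !normrM ltr_pM ?normr_ge0 ?H ?mem_head //.
by apply: IH => c hc; apply: H; rewrite inE hc orbT.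
Qed.

Lemma bnum_lt_bden s z : s != [::] -> in_disk s -> `|z| < 1 -> `|(bnum s).[z]| < `|(bden s).[z]|.
Proof.
by move=> s0 hs hz; rewrite bnumE bdenE; apply: prod_norm_lt => // a /hs ha; apply: factor_lt.
Qed.

Lemma bden_lt_bnum s z : s != [::] -> in_disk s -> 1 < `|z| -> `|(bden s).[z]| < `|(bnum s).[z]|.
Proof.
by move=> s0 hs hz; rewrite bnumE bdenE; apply: prod_norm_lt => // a /hs ha; apply: factor_gt.
Qed.

Lemma bden_neq0 s z : in_disk s -> `|z| <= 1 -> (bden s).[z] != 0.
Proof.
move=> hs hz; rewrite bdenE prodf_seq_neq0; apply/allP => a ha /=.
rewrite subr_eq0; apply/negP => /eqP h.
have : `|a| * `|z| < 1 by apply: le_lt_trans (hs a ha); rewrite ler_piMr.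
by rewrite -norm_conjC -normrM -h normr1 ltxx.
Qed.

(** On the circle [1 - a^* * z] is [z] times the conjugate of [z - a], so [bden s] is the conjugate
    reversal of [bnum s]. *)
Lemma bden_circle s z : `|z| = 1 -> (bden s).[z] = z ^+ size s * ((bnum s).[z])^*.
Proof.
move=> hz; have z0 := circle_neq0 hz; rewrite bdenE bnumE.
elim: s => [|a s IH]; first by rewrite !big_nil rmorph1 mulr1.
rewrite !big_cons IH rmorphM rmorphB /= (circle_conj hz) exprS.
have -> : 1 - a^* * z = z * (z^-1 - a^*) by rewrite mulrBr divff // [z * _]mulrC.
ring.
Qed.

Lemma bnum_circle s z : `|z| = 1 -> (bnum s).[z] = z ^+ size s * ((bden s).[z])^*.
Proof.
move=> hz; rewrite bden_circle // rmorphM /= conjCK rmorphXn /= mulrA -exprMn.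
by rewrite -normCK hz !expr1n mul1r.
Qed.

(** If [|y| = |z| = 1], then [z] times the conjugate of [z - y] is [- y^-1 * (z - y)]. Reversal thus
    only rescales [p], and it preserves a span of two such polynomials. *)
Lemma circle_rooted_conj m (p : {poly C}) : circle_rooted m p ->
  exists e : C, forall z, `|z| = 1 -> z ^+ m * (p.[z])^* = e * p.[z].
Proof.
case=> c [rs [c0 <- hrs ->]].
exists (c^* / c * \prod_(y <- rs) (- y^-1)) => z hz; have z0 := circle_neq0 hz.
rewrite !hornerZ -/(bnum rs) rmorphM /= !bnumE.
suff : \prod_(y <- rs) (- y^-1) * \prod_(y <- rs) (z - y) =
    z ^+ size rs * (\prod_(y <- rs) (z - y))^*.
  by move=> h; rewrite mulrCA -h; field.
elim: rs hrs => [|y rs IH] hrs; first by rewrite !big_nil rmorph1 mulr1.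
have hy : `|y| = 1 by apply: hrs; rewrite mem_head.
have y0 := circle_neq0 hy.
rewrite !big_cons [size _]/= exprS rmorphM rmorphB /= (circle_conj hz) (circle_conj hy).
have {}IH := IH (fun v hv => hrs v (@mem_behead _ (y :: rs) v hv)).
have -> : - y^-1 * \prod_(j <- rs) (- j^-1) * ((z - y) * \prod_(j <- rs) (z - j)) =
  (- y^-1 * (z - y)) * (\prod_(j <- rs) (- j^-1) * \prod_(j <- rs) (z - j)) by ring.
rewrite IH; move: (z ^+ size rs) (_^*) => u v; by field; rewrite y0 z0.
Qed.

(** The degree bounds add up to the degree of the product with no slack. This gives every pencil
    member in the factorization the full degree [m]. *)
Lemma size_prod_full m (ps : seq {poly C}) :
  (forall p, p \in ps -> (size p <= m.+1)%N) ->
  size (\prod_(p <- ps) p) = (size ps * m).+1 ->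
  forall p, p \in ps -> size p = m.+1.
Proof.
have bound (qs : seq {poly C}) : (forall p, p \in qs -> (size p <= m.+1)%N) ->
    (size (\prod_(p <- qs) p)%R <= (size qs * m).+1)%N.
  elim: qs => [|q qs IH] hqs; first by rewrite big_nil size_poly1.
  rewrite big_cons (leq_trans (size_polyMleq _ _)) //.
  have h1 := hqs q (mem_head _ _); have h2 := IH (fun v hv => hqs v (@mem_behead _ (q :: qs) v hv)).
  by rewrite /= mulSn; move: h1 h2; move: (size q) (size (\prod_(j <- qs) j)) => u v; lia.
elim: ps => // q ps IH hps; rewrite big_cons /= => e p.
have h1 := hps q (mem_head _ _); have hp' v hv := hps v (@mem_behead _ (q :: ps) v hv).
have h2 := bound _ hp'.
have nz : q * \prod_(j <- ps) j != 0 by rewrite -size_poly_eq0 e.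
move: nz; rewrite mulf_eq0 negb_or => /andP[q0 ps0].
rewrite size_mul // in e.
have s0 : (0 < size q)%N by rewrite size_poly_gt0.
have [eq1 eq2] : size q = m.+1 /\ size (\prod_(j <- ps) j) = (size ps * m).+1.
  move: h1 h2 e s0; rewrite /= mulSn; move: (size q) (size (\prod_(j <- ps) j)) => u v; lia.
by rewrite inE => /predU1P[-> //|]; apply: IH.
Qed.

Lemma all_roots_in_disk m (p : {poly C}) : size p = m.+1 ->
  (forall r, root p r -> `|r| < 1) ->
  exists l d, [/\ l != 0, size d = m, in_disk d & p = l *: bnum d].
Proof.
move=> sp hr; have [d ed] := closed_field_poly_normal p.
have p0 : p != 0 by rewrite -size_poly_eq0 sp.
have l0 : lead_coef p != 0 by rewrite lead_coef_eq0.
exists (lead_coef p), d; split=> //.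
  by move: sp; rewrite ed size_scale // size_prod_XsubC => - [].
by move=> a ha; apply: hr; rewrite ed rootZ // root_prod_XsubC.
Qed.

(** The factors have degree [m] and their roots, being roots of [bnum s], lie in the disk; the roots
    of one of them are the zeros [d] of the inner product. Its numerator [L] and denominator [M]
    span the pencil, so each factor is a multiple of some [L - v M], and dividing by [M] produces
    the outer Blaschke factors. *)
Lemma blaschke_from_pencil (g c : C) s k m (P Q : {poly C}) (ts : seq (C * C)) :
  `|g| = 1 -> in_disk s -> (0 < k)%N -> (0 < m)%N -> size s = (k * m)%N ->
  circle_rooted m P -> circle_rooted m Q -> size ts = k ->
  g *: bnum s = c *: \prod_(t <- ts) lin P Q t ->
  exists gC cs d, [/\ `|gC| = 1, size cs = k /\ in_disk cs, size d = m /\ in_disk d &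
    forall z, `|z| <= 1 -> (g *: bnum s).[z] / (bden s).[z] =
      gC * \prod_(a <- cs) (((bnum d).[z] / (bden d).[z] - a)
                            / (1 - a^* * ((bnum d).[z] / (bden d).[z])))].
Proof.
move=> hg hs k0 m0 ss hP hQ sts e.
have g0 := circle_neq0 hg.
have size_circ p : circle_rooted m p -> size p = m.+1.
  by case=> b [rs [b0 <- _ ->]]; rewrite size_scale // size_prod_XsubC.
have size_lin t : (size (lin P Q t) <= m.+1)%N.
  rewrite (leq_trans (size_polyD _ _)) // geq_max.
  by rewrite !(leq_trans (size_scale_leq _ _)) // size_circ.
have c0 : c != 0.
  apply: contra_eq_neq e => ->; rewrite scale0r scaler_eq0 negb_or g0 /=.
  by rewrite monic_neq0 ?monic_prod_XsubC.
have lin_size t : t \in ts -> size (lin P Q t) = m.+1.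
  move=> ht; apply: (@size_prod_full _ [seq lin P Q t | t <- ts]).
  - by move=> p /mapP[t' _ ->].
  - rewrite big_map size_map sts -(size_scale _ c0) -e size_scale // size_prod_XsubC.
    by rewrite ss.
  - exact: map_f.
have lin_root t r : t \in ts -> root (lin P Q t) r -> `|r| < 1.
  move=> ht hr; apply: hs; rewrite -(root_prod_XsubC s) -/(bnum s) -(rootZ _ _ g0) e.
  by rewrite rootZ // (big_rem t ht) /= rootM hr.
have [t0 ht0] : exists t, t \in ts.
  by case: (ts) sts k0 => [<-//|t ts' _ _]; exists t; rewrite mem_head.
have [l0 [d [l00 sd hd eL]]] := all_roots_in_disk (lin_size _ ht0) (lin_root t0 ^~ ht0).
have d0 : d != [::] by rewrite -size_eq0 sd; lia.
set L := bnum d in eL; set M := bden d.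
have LM z : `|z| = 1 -> z ^+ m * (L.[z])^* = M.[z] by move=> hz; rewrite /M bden_circle // sd.
have ML z : `|z| = 1 -> z ^+ m * (M.[z])^* = L.[z] by move=> hz; rewrite /L bnum_circle // sd.
have [al [be eL']] : exists al be, L = al *: P + be *: Q.
  exists (l0^-1 * t0.1), (l0^-1 * t0.2).
  by rewrite -!scalerA -scalerDr -/(lin P Q t0) eL scalerA mulVf // scale1r.
have [eP heP] := circle_rooted_conj hP; have [eQ heQ] := circle_rooted_conj hQ.
pose al' := al^* * eP; pose be' := be^* * eQ.
(* Reversal preserves the span of [P] and [Q] and sends [L] to [M]. *)
have eM : M = al' *: P + be' *: Q.
  apply: eq_on_circle => z hz; rewrite -LM // eL' !(hornerD, hornerZ) rmorphD !rmorphM /=.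
  by rewrite mulrDr !(mulrCA (z ^+ m)) heP // heQ // /al' /be' !mulrA.
(* The determinant of the passage from [P], [Q] to [L], [M]. If it were zero, evaluation at a root
   of [L], where [M] does not vanish, would force [L = 0]. *)
pose D := al * be' - al' * be.
have [a ha] : exists a, a \in d by case: (d) d0 => // a d' _; exists a; rewrite mem_head.
have La : L.[a] = 0 by apply/rootP; rewrite root_prod_XsubC.
have Ma : M.[a] != 0 by rewrite bden_neq0 // ltW // hd.
have D0 : D != 0.
  apply/negP => /eqP D0.
  have h1 : be' *: L - be *: M = D *: P.
    rewrite eL' eM !scalerDr !scalerA opprD addrACA -!scalerBl [be' * be]mulrC subrr.
    by rewrite scale0r addr0 /D; congr (_ *: _); ring.
  have h2 : al' *: L - al *: M = - D *: Q.
    rewrite eL' eM !scalerDr !scalerA opprD addrACA -!scalerBl [al' * al]mulrC subrr.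
    by rewrite scale0r add0r /D; congr (_ *: _); ring.
  have b0 : be = 0.
    have := congr1 (horner^~ a) h1; rewrite D0 scale0r !hornerE La mulr0 sub0r => /eqP.
    by rewrite oppr_eq0 mulf_eq0 (negbTE Ma) orbF => /eqP.
  have a0 : al = 0.
    have := congr1 (horner^~ a) h2; rewrite D0 oppr0 scale0r !hornerE La mulr0 sub0r => /eqP.
    by rewrite oppr_eq0 mulf_eq0 (negbTE Ma) orbF => /eqP.
  have : L != 0 by rewrite monic_neq0 ?monic_prod_XsubC.
  by rewrite eL' a0 b0 !scale0r addr0 eqxx.
have linE t : exists u, lin P Q t = lin L M u.
  exists ((t.1 * be' - t.2 * al') / D, (t.2 * al - t.1 * be) / D).
  have dv y : D * (y / D) = y by rewrite mulrC divfK.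
  apply: (scalerI D0); rewrite /lin /= !scalerDr !scalerA !dv.
  rewrite eL' eM !scalerDr !scalerA addrACA -!scalerDl /D.
  by congr (_ *: _ + _ *: _); ring.
have factorE t : t \in ts -> exists v : C * C,
    [/\ v.1 != 0, `|v.2| < 1 & lin P Q t = v.1 *: (L - v.2 *: M)].
  move=> ht; have [u eu] := linE t.
  have [l [d' [l_n0 sd' hd' el]]] := all_roots_in_disk (lin_size _ ht) (lin_root t ^~ ht).
  have [r hr] : exists r, r \in d'.
    by case: (d') sd' m0 => [<-//|r d'' _ _]; exists r; rewrite mem_head.
  have r1 : `|r| < 1 by exact: hd'.
  have Mr : M.[r] != 0 by rewrite bden_neq0 // ltW.
  have rr : u.1 * L.[r] + u.2 * M.[r] = 0.
    rewrite -!hornerZ -hornerD -/(lin L M u) -eu; apply/rootP.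
    by rewrite el rootZ // root_prod_XsubC.
  have u10 : u.1 != 0.
    apply/negP => /eqP u10; move: rr; rewrite u10 mul0r add0r => /eqP.
    rewrite mulf_eq0 (negbTE Mr) orbF => /eqP u20.
    have z : lin P Q t = 0 by rewrite eu /lin u10 u20 !scale0r addr0.
    by have := lin_size _ ht; rewrite z size_poly0.
  exists (u.1, - (u.2 / u.1)); split=> //=; last first.
    by rewrite eu /lin scaleNr opprK scalerDr scalerA mulrC divfK.
  (* The coefficient is the value of a Blaschke product at a point [r] of the disk, hence of modulus
     below 1. *)
  have : - (u.2 / u.1) = L.[r] / M.[r].
    apply/eqP; rewrite eq_sym -mulNr eqr_div // -subr_eq0; apply/eqP.
    by rewrite -[RHS]rr; ring.
  by move=> ->; rewrite normrM normfV ltr_pdivrMr ?normr_gt0 // mul1r bnum_lt_bden.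
have [vs [svs hvs [ka [ka0 ekap]]]] : exists vs : seq C, [/\ size vs = k, in_disk vs &
    exists ka, ka != 0 /\ g *: bnum s = ka *: \prod_(v <- vs) (L - v *: M)].
  rewrite e -sts; elim: (ts) factorE => [|t ts' IH] H.
    by exists [::]; split=> //; exists c; rewrite !big_nil.
  have [|vs [svs hvs [ka [ka0 ek]]]] := IH; first by move=> v hv; apply: H; rewrite inE hv orbT.
  have [[v1 v2] /= [v10 v21 ev]] := H t (mem_head _ _).
  exists (v2 :: vs); split; rewrite /= ?svs //.
    by move=> w; rewrite inE => /predU1P[-> //|]; exact: hvs.
  exists (v1 * ka); split; first by rewrite mulf_neq0.
  by rewrite !big_cons ev -[in RHS]scalerA [ka *: _]scalerAr -ek -scalerAl -scalerAr !scalerA mulrC.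
(* Reversing the factorization of the numerator factors the denominator, since [L] and [M] are
   exchanged. *)
have eden : bden s = (g * ka^*) *: \prod_(v <- vs) (M - v^* *: L).
  apply: eq_on_circle => z hz; rewrite bden_circle // ss.
  have -> : bnum s = g^-1 *: (g *: bnum s) by rewrite scalerA mulVf // scale1r.
  rewrite ekap !hornerZ !rmorphM /= circle_conj ?normfV ?hg ?invr1 // invrK.
  rewrite mulrCA -!mulrA; congr (g * _); rewrite mulrCA; congr (_ * _).
  rewrite -svs; elim: (vs) => [|v vs' IH].
    by rewrite !big_nil mul0n expr0 mul1r !hornerC rmorph1.
  rewrite !big_cons !hornerM /= mulSn exprD -IH rmorphM /= mulrACA; congr (_ * _).
  rewrite !(hornerD, hornerN, hornerZ) rmorphB rmorphM /=.
  by rewrite mulrBr mulrCA LM // ML.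
exists (ka / (g * ka^*)), vs, d; split=> //.
  rewrite normrM normfV normrM hg mul1r norm_conjC divff // normr_eq0 //.
move=> z hz; have Mz : M.[z] != 0 by rewrite bden_neq0.
rewrite ekap eden !hornerZ.
have kc0 : ka^* != 0 by rewrite conjC_eq0.
rewrite -/L -/M.
have h : (\prod_(v <- vs) (L - v *: M)).[z] / (\prod_(v <- vs) (M - v^* *: L)).[z] =
   \prod_(a0 <- vs) ((L.[z] / M.[z] - a0) / (1 - a0^* * (L.[z] / M.[z]))).
  rewrite horner_prod [X in _ / X]horner_prod -prodf_div; apply: eq_big_seq => v hv.
  rewrite !(hornerD, hornerN, hornerZ).
  have <- : M.[z] * (L.[z] / M.[z] - v) = L.[z] - v * M.[z] by field.
  have <- : M.[z] * (1 - v^* * (L.[z] / M.[z])) = M.[z] - v^* * L.[z] by field.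
  by rewrite -mulf_div divff // mul1r.
by rewrite -h invfM mulrACA.
Qed.

End BlaschkeFraction.

(** * Level sets and their cyclic order *)

Section Orientation.
Variable C : numClosedFieldType.
Implicit Types (z u v w : C).

(* [cross] over an abstract closed field. *)
Definition orient u v w : C := 'Im ((v - u)^* * (w - u)).

Lemma orientE u v w : orient u v w =
  'i * ((v - u) * (w^* - u^*) - (v^* - u^*) * (w - u)) / 2.
Proof. by rewrite /orient ImE rmorphM /= conjCK !rmorphB. Qed.

Lemma orient_swap u v w : orient v u w = - orient u v w.
Proof. by rewrite !orientE; ring. Qed.

Lemma orient_rot u v w : orient u v w = orient w u v.
Proof. by rewrite !orientE; ring. Qed.

Lemma orient_refl u v : orient u v u = 0.
Proof. by rewrite /orient subrr mulr0 raddf0. Qed.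

(* Up to sign, the cotangent of half the angle from z to w. *)
Definition tau z w : C := 'i * ((w + z) / (w - z)).

Lemma tau_real z w : `|z| = 1 -> `|w| = 1 -> w != z -> tau z w \is Num.real.
Proof.
move=> hz hw wz; have [z0 w0] := (circle_neq0 hz, circle_neq0 hw).
have d : w - z != 0 by rewrite subr_eq0.
apply/CrealP; rewrite /tau !rmorphM fmorphV rmorphB rmorphD /= conjCi !circle_conj //.
have d' : w^-1 - z^-1 != 0 by rewrite subr_eq0 (inj_eq invr_inj).
by field; rewrite w0 z0 d mulN1r subr_eq0 eq_sym wz.
Qed.

(** [tau z] is a real coordinate on the circle without [z]. In it the orientation of three points is
    a Vandermonde product times a positive number, so its sign can be read off from their order. *)
Lemma orient_tau z u v w : `|z| = 1 -> `|u| = 1 -> `|v| = 1 -> `|w| = 1 ->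
  u != z -> v != z -> w != z ->
  orient u v w = (tau z v - tau z u) * (tau z w - tau z u) * (tau z v - tau z w)
    * ((`|u - z| * `|v - z| * `|w - z|) ^+ 2 / 16).
Proof.
move=> hz hu hv hw uz vz wz.
have [[z0 u0] [v0 w0]] := ((circle_neq0 hz, circle_neq0 hu), (circle_neq0 hv, circle_neq0 hw)).
rewrite orientE /tau -!mulrBr !exprMn !normCK !rmorphB /= !circle_conj //.
set a := (v + z) / _ - _; set b := (w + z) / _ - _; set c := (v + z) / _ - _.
have -> : 'i * a * ('i * b) * ('i * c) = - 'i * (a * b * c) :> C.
  by rewrite -[X in _ = X * _]mulN1r -(sqrCi C); ring.
by rewrite /a /b /c; field; rewrite u0 v0 w0 z0 !subr_eq0 uz vz wz.
Qed.

Lemma orient_tau0 z v w : `|z| = 1 -> `|v| = 1 -> `|w| = 1 -> v != z -> w != z ->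
  orient z v w = (tau z v - tau z w) * ((`|v - z| * `|w - z|) ^+ 2 / 4).
Proof.
move=> hz hv hw vz wz.
have [z0 [v0 w0]] := (circle_neq0 hz, (circle_neq0 hv, circle_neq0 hw)).
rewrite orientE /tau -!mulrBr !exprMn !normCK !rmorphB /= !circle_conj //.
by field; rewrite v0 w0 z0 !subr_eq0 vz wz.
Qed.

(** The points other than [z] are sorted by [tau z], and [z], the point at infinity of this
    coordinate, comes first; the list is repeated periodically. *)
Lemma cyclic_enumeration z (rs : seq C) : uniq rs -> (forall w, w \in rs -> `|w| = 1) ->
  z \in rs -> (1 < size rs)%N ->
  exists x : nat -> C, [/\ x 0%N = z, forall i, x (i + size rs)%N = x i,
    perm_eq [seq x i | i <- iota 0 (size rs)] rs &
    forall i w, w \in rs -> orient (x i) (x i.+1) w <= 0].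
Proof.
move=> urs hrs zrs; set n := size rs => n1.
pose le := fun v w => tau z v <= tau z w.
pose t := sort le (rem z rs).
have mt w : (w \in t) = (w != z) && (w \in rs) by rewrite mem_sort mem_rem_uniq.
have tot : {in [pred w | tau z w \is Num.real] &, total le}.
  by move=> v w; rewrite !inE; apply: real_leVge.
have hz := hrs _ zrs.
have tr : all [pred w | tau z w \is Num.real] (rem z rs).
  apply/allP => w; rewrite mem_rem_uniq // inE => /andP[wz wr].
  by apply: tau_real => //; apply: hrs.
have st : sorted le t := sort_sorted_in tot tr.
have sz : size t = n.-1 by rewrite size_sort size_rem.
have letr : transitive le by move=> a b c; apply: le_trans.
have lerf : reflexive le by move=> a; apply: lexx.
have mono := sorted_leq_nth letr lerf z st.
pose x i := nth z (z :: t) (i %% n).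
have szt : size (z :: t) = n by rewrite /= sz prednK // ltnW.
have inrs w : w \in z :: t = (w \in rs).
  by rewrite inE mt; case: eqP => [->|_] /=; rewrite ?zrs.
have ut : uniq (z :: t) by rewrite /= mt eqxx sort_uniq rem_uniq.
exists x; split.
- by rewrite /x mod0n.
- by move=> i; rewrite /x modnDr.
- have -> : [seq x i | i <- iota 0 n] = z :: t.
    rewrite -[RHS](mkseq_nth z) szt; apply/eq_in_map => i; rewrite mem_iota => /andP[_ hi].
    by rewrite /x modn_small.
  by apply: uniq_perm => // w; rewrite inrs.
move=> i w wrs; rewrite /x.
have n0 : (0 < n)%N by exact: ltnW.
have {i} [j [hj -> ->]] : exists j, [/\ (j < n)%N, (i %% n)%N = j &
    (i.+1 %% n)%N = if j.+1 == n then 0%N else j.+1].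
  exists (i %% n)%N; rewrite ltn_pmod //; split=> //.
  rewrite -addn1 -modnDml addn1; case: eqP => [->|/eqP h]; first by rewrite modnn.
  by rewrite modn_small // ltn_neqAle h ltn_pmod.
have tnth j' : (j' < size t)%N -> [/\ nth z t j' \in rs, nth z t j' != z & `|nth z t j'| = 1].
  by move=> h; have := mem_nth z h; rewrite mt => /andP[h1 h2]; split=> //; apply: hrs.
have hw := hrs _ wrs.
have windex : w != z -> exists2 l, (l < size t)%N & w = nth z t l.
  move=> wz; have : w \in t by rewrite mt wz.
  by move=> h; exists (index w t); rewrite ?index_mem // nth_index.
(* The closing edge, back to [z], is treated first, then the edge leaving [z], then those between
   sorted points. *)
case: eqP => [ej|ne] /=.
  case: j hj ej => [|j] hj ej; first by rewrite ej ltnn in n1.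
  have [|h1 h2 h3] := tnth j; first by rewrite sz -ej.
  rewrite /= orient_swap oppr_le0.
  have [->|wz] := eqVneq w z; first by rewrite orient_refl.
  have [l hl ew] := windex wz.
  rewrite orient_tau0 // mulr_ge0 ?divr_ge0 ?sqr_ge0 ?exprn_ge0 ?mulr_ge0 //.
  rewrite subr_ge0 ew; apply: mono; rewrite ?inE //; first by rewrite sz -ej.
  by move: hl; rewrite sz -ej.
have sj : (j < size t)%N by rewrite sz; lia.
have [v1 v2 v3] := tnth _ sj.
case: j hj ne sj v1 v2 v3 => [|j] hj ne sj v1 v2 v3 /=.
  have [->|wz] := eqVneq w z; first by rewrite orient_refl.
  have [l hl ew] := windex wz.
  rewrite orient_tau0 // mulr_le0_ge0 ?divr_ge0 ?exprn_ge0 ?mulr_ge0 //.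
  by rewrite subr_le0 ew; apply: mono; rewrite ?inE.
have sj' : (j < size t)%N by exact: ltnW.
have [u1 u2 u3] := tnth _ sj'.
have uv : tau z (nth z t j) <= tau z (nth z t j.+1) by apply: mono; rewrite ?inE.
have [->|wz] := eqVneq w z.
  rewrite orient_rot orient_tau0 // mulr_le0_ge0 ?divr_ge0 ?exprn_ge0 ?mulr_ge0 //.
  by rewrite subr_le0.
have [l hl ew] := windex wz.
rewrite (orient_tau hz) // mulr_le0_ge0 ?divr_ge0 ?exprn_ge0 ?mulr_ge0 //.
rewrite -mulrA mulr_ge0_le0 ?subr_ge0 // ew.
(* The coordinate of [w] is never strictly between two consecutive ones. *)
have [lj|lj] := leqP l j.
  have h1 : tau z (nth z t l) <= tau z (nth z t j) by apply: mono; rewrite ?inE.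
  by rewrite mulr_le0_ge0 ?subr_le0 ?subr_ge0 // (le_trans h1).
have h1 : tau z (nth z t j.+1) <= tau z (nth z t l) by apply: mono; rewrite ?inE.
by rewrite mulr_ge0_le0 ?subr_le0 ?subr_ge0 // (le_trans uv).
Qed.

End Orientation.

(** * Level sets of a Blaschke product: full degree, roots on the circle, simplicity *)

Section LevelSets.
Variable C : numClosedFieldType.
Implicit Types (z w r a : C) (s : seq C).

(** The degree of [bden s] drops when some [a] is zero, hence the coefficient at index [size s] in
    place of the leading one. *)
Lemma bden_top s :
  (size (bden s) <= (size s).+1)%N /\ (bden s)`_(size s) = \prod_(a <- s) (- a^*).
Proof.
elim: s => [|a s [IH1 IH2]]; first by rewrite /bden !big_nil size_poly1 coef1.
rewrite /bden !big_cons -/(bden s) /= mulrBl mul1r -scalerAl mulrC.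
split.
  rewrite (leq_trans (size_polyD _ _)) // geq_max (leq_trans IH1) //= size_polyN.
  rewrite (leq_trans (size_scale_leq _ _)) // (leq_trans (size_polyMleq _ _)) //.
  by rewrite size_polyX addn2.
by rewrite coefB coefZ coefMX /= nth_default // sub0r IH2 mulNr mulrC.
Qed.

Lemma norm_bnum_bden s z : `|z| = 1 -> `|(bnum s).[z]| = `|(bden s).[z]|.
Proof. by move=> hz; rewrite bnum_circle // normrM normrX hz expr1n mul1r norm_conjC. Qed.

Lemma bnum_circle_neq0 s z : in_disk s -> `|z| = 1 -> (bnum s).[z] != 0.
Proof.
by move=> hs hz; rewrite -normr_gt0 norm_bnum_bden // normr_gt0 bden_neq0 // hz.
Qed.

(* On the circle, z B'(z) / B(z) is the positive number \sum_a (1 - |a|^2) / |z - a|^2. *)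
Lemma bnum_wronskian s z : in_disk s -> `|z| = 1 -> exists2 t : C,
  0 <= t /\ (s != [::] -> 0 < t) &
  (bnum s)^`().[z] * (bden s).[z] - (bnum s).[z] * (bden s)^`().[z]
    = t / z * ((bnum s).[z] * (bden s).[z]).
Proof.
move=> hs hz; have z0 := circle_neq0 hz.
elim: s hs => [|a s IH] hs.
  by exists 0; rewrite ?lexx //= /bnum /bden !big_nil -polyC1 derivC !hornerC; ring.
have [|t [t0 _] e] := IH; first by move=> b hb; apply: hs; rewrite inE hb orbT.
have ha : `|a| < 1 by apply: hs; rewrite mem_head.
have za : z - a != 0.
  by rewrite subr_eq0; apply: contraTneq ha => <-; rewrite hz ltxx.
pose t' := t + (1 - `|a| ^+ 2) / `|z - a| ^+ 2.
have t'0 : 0 < t'.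
  by apply: ltr_wpDl => //; rewrite divr_gt0 ?disk_factor // exprn_gt0 // normr_gt0.
exists t'; first by split=> //; apply: ltW.
have zca : 1 - a^* * z != 0.
  have := @bden_neq0 _ [:: a] z; rewrite bdenE big_seq1; apply; rewrite ?hz //.
  by move=> b; rewrite inE => /eqP ->.
rewrite /bnum /bden !big_cons -/(bnum s) -/(bden s) !derivM !derivE !hornerE.
rewrite /t' !normCK rmorphB /= (circle_conj hz).
set N := (bnum s).[z] in e *; set M := (bden s).[z] in e *.
set N' := _^`().[z] in e *; set M' := _^`().[z] in e *.
have za' : z^-1 - a^* != 0.
  by apply: contraNneq zca => h; rewrite -(mulVf z0) -mulrBl h mul0r.
apply: (@etrans _ _ ((z - a) * (1 - a^* * z) * (N' * M - N * M')
   + N * M * ((1 - a^* * z) + (z - a) * a^*))); first by ring.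
rewrite e.
have -> : 1 - a^* * z = z * (z^-1 - a^*) by field.
by field; rewrite z0 za mulNr /= zca.
Qed.

Variables (g : C) (s : seq C).
Hypothesis g1 : `|g| = 1.
Hypothesis hs : in_disk s.
Hypothesis s0 : s != [::].

Local Notation num := (g *: bnum s).
Local Notation den := (bden s).
Local Notation n := (size s).

Lemma norm_num_den z : `|z| = 1 -> `|num.[z]| = `|den.[z]|.
Proof. by move=> hz; rewrite hornerZ normrM g1 mul1r norm_bnum_bden. Qed.

(** Numerator and denominator have equal modulus at [z], and the second contribution carries the
    extra factor [\prod |a| < 1]. *)
Lemma level_lead_neq0 z : `|z| = 1 -> (level num den z)`_n != 0.
Proof.
move=> hz; rewrite coefB !coefZ (bden_top s).2.
have -> : (bnum s)`_n = 1.
  have /monicP := monic_prod_XsubC s predT id.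
  by rewrite lead_coefE size_prod_XsubC.
rewrite mulr1 subr_eq0; apply/negP => /eqP h.
have : `|num.[z] * \prod_(a <- s) (- a^*)| < `|den.[z]|.
  rewrite normrM norm_num_den // gtr_pMr ?normr_gt0 ?bden_neq0 ?hz //.
  rewrite -[X in _ < X](normr1 C) -[X in _ < `|X|](@big1_eq _ _ *%R _ s predT).
  apply: prod_norm_lt => // a ha.
  by rewrite normrN norm_conjC normr1 hs.
by rewrite -h normrM g1 mulr1 ltxx.
Qed.

Lemma size_level z : `|z| = 1 -> size (level num den z) = n.+1.
Proof.
move=> hz; apply/eqP; rewrite eqn_leq; apply/andP; split; last first.
  by rewrite ltnNge; apply: contraNN (level_lead_neq0 hz) => h; rewrite nth_default.
rewrite (leq_trans (size_polyD _ _)) // geq_max size_polyN.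
by rewrite !(leq_trans (size_scale_leq _ _)) ?(bden_top s).1 ?size_prod_XsubC.
Qed.

(** A root gives numerator and denominator the same modulus, which fails inside and outside the
    circle. *)
Lemma level_root_circle z r : `|z| = 1 -> root (level num den z) r -> `|r| = 1.
Proof.
move=> hz; rewrite /root hornerD hornerN !hornerZ subr_eq0 => /eqP h.
have {}h : `|(bnum s).[r]| = `|den.[r]|.
  have hd : `|den.[z]| != 0 by rewrite normr_eq0 bden_neq0 ?hz.
  apply: (mulfI hd); rewrite -[in RHS]norm_num_den // -[in RHS]normrM hornerZ -h.
  by rewrite !normrM g1 mul1r.
case: (real_ltgtP (normr_real r) (real1 C)) => // h'.
- by have := bnum_lt_bden s0 hs h'; rewrite h ltxx.
- by have := bden_lt_bnum s0 hs h'; rewrite h ltxx.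
Qed.

Lemma level_set z : `|z| = 1 -> exists rs : seq C,
  [/\ uniq rs, size rs = n, forall w, w \in rs <-> `|w| = 1 /\ root (level num den z) w &
   level num den z = (level num den z)`_n *: \prod_(r <- rs) ('X - r%:P)].
Proof.
move=> hz; have [rs ers] := closed_field_poly_normal (level num den z).
have sl := size_level hz.
have lc : lead_coef (level num den z) = (level num den z)`_n by rewrite lead_coefE sl.
have lc0 := level_lead_neq0 hz; rewrite lc in ers.
have srs : size rs = n by move: sl; rewrite ers size_scale // size_prod_XsubC => - [].
exists rs; split=> //.
(* A double root would annihilate the Wronskian, which has no zero on the circle. *)
- rewrite -separable_prod_XsubC unlock; apply/Pdiv.ClosedField.coprimepP => r rr.
  have rl : root (level num den z) r by rewrite ers rootZ.
  have r1 := level_root_circle hz rl.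
  have [t [_ /(_ s0) t0] e] := bnum_wronskian hs r1.
  apply/negP => /eqP dr.
  have dl : (level num den z)^`().[r] = 0 by rewrite ers derivZ hornerZ dr mulr0.
  move: rl dl; rewrite /root /level derivB !derivZ !(hornerD, hornerN, hornerZ) => /eqP h1 h2.
  have h3 : den.[z] * g * ((bnum s)^`().[r] * den.[r] - (bnum s).[r] * den^`().[r]) = 0.
    have -> : den.[z] * g * ((bnum s)^`().[r] * den.[r] - (bnum s).[r] * den^`().[r]) =
      (den.[z] * (g * (bnum s)^`().[r]) - g * (bnum s).[z] * den^`().[r]) * den.[r]
      - (den.[z] * (g * (bnum s).[r]) - g * (bnum s).[z] * den.[r]) * den^`().[r] by ring.
    by rewrite h1 h2 !mul0r subrr.
  move/eqP: h3; apply/negP; rewrite e !mulf_neq0 ?invr_neq0 ?(lt0r_neq0 t0) ?bden_neq0 //.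
  all: rewrite ?bnum_circle_neq0 ?(circle_neq0 g1) ?(circle_neq0 r1) ?hz ?r1 //.
- move=> w; rewrite -(root_prod_XsubC rs) -(rootZ _ _ lc0) -ers.
  by split=> [h|[]//]; split=> //; apply: level_root_circle h.
Qed.

Lemma level_self z : root (level num den z) z.
Proof. by rewrite /root hornerD hornerN !hornerZ; apply/eqP; ring. Qed.

End LevelSets.

(** * Tangents of an ellipse *)

Section Ellipse.
Variable C : numClosedFieldType.
Implicit Types (z u v w f d c e r h k : C).

Lemma dotE c z : 'Re (c^* * z) = (c^* * z + c * z^*) / 2.
Proof. by rewrite ReE rmorphM /= conjCK. Qed.

Lemma real_ler_of_sqr h k : h \is Num.real -> 0 <= k -> h ^+ 2 <= k ^+ 2 -> h <= k.
Proof.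
move=> hr k0 le; apply: le_trans (real_ler_norm hr) _.
by rewrite -(@ler_pXn2r _ 2) ?nnegrE // real_normK.
Qed.

(* The support function of an ellipse with foci [f1], [f2] and major axis [d] in the direction [c]
   is [Re (c^* (f1 + f2) / 2) + h], [h^2 = (d^2 - |f1 - f2|^2) |c|^2 / 4 + Re (c^* (f1 - f2) / 2)^2]. *)
Lemma ellipse_support f1 f2 d c r :
  `|f1 - f2| < d -> c != 0 ->
  (forall z, `|z - f1| + `|z - f2| = d -> 'Re (c^* * z) <= r) ->
  (exists2 z, `|z - f1| + `|z - f2| = d & 'Re (c^* * z) = r) ->
  4 * ((r - 'Re (c^* * f1)) * (r - 'Re (c^* * f2))) = (d ^+ 2 - `|f1 - f2| ^+ 2) * `|c| ^+ 2.
Proof.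
move=> hd c0 hle [z1 hz1 hr].
have n2 : `|2 : C| = 2 by rewrite ger0_norm ?ler0n.
(* Centre [m], half focal vector [e], semi-major axis [a]. Below, [b2] is the squared semi-minor
   axis and [h0] the support function measured from the centre. *)
have [m [e [a [f1E f2E dE]]]] : exists m e a : C, [/\ f1 = m + e, f2 = m - e & d = 2 * a].
  by exists ((f1 + f2) / 2), ((f1 - f2) / 2), (d / 2); split; field.
have feE : `|f1 - f2| = 2 * `|e|.
  by rewrite -[X in X * _]n2 -normrM; congr `|_|; rewrite f1E f2E; ring.
have ae : `|e| < a by move: hd; rewrite feE dE ltr_pM2l // ltr0n.
have a0 : 0 < a by apply: le_lt_trans ae.
have [b2 b2E] : {b2 | b2 = a ^+ 2 - `|e| ^+ 2} by eexists.
have b20 : 0 < b2 by rewrite b2E subr_gt0 ltrXn2r // ltW.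
have [p pE0] : {p | p = 'Re (c^* * e)} by eexists.
have pr : p \is Num.real by rewrite pE0 Creal_Re.
have [h0 h0E0] : {h0 | h0 = sqrtC (b2 * `|c| ^+ 2 + p ^+ 2)} by eexists.
have X0 : p ^+ 2 < b2 * `|c| ^+ 2 + p ^+ 2.
  by rewrite ltrDr mulr_gt0 // exprn_gt0 // normr_gt0.
have p20 : 0 <= p ^+ 2 by rewrite real_exprn_even_ge0.
have h00 : 0 < h0 by rewrite h0E0 sqrtC_gt0 (le_lt_trans p20).
have h0E : h0 ^+ 2 = b2 * `|c| ^+ 2 + p ^+ 2 by rewrite h0E0 sqrtCK.
have hne : h0 != 0 by rewrite gt_eqF.
have [ph nph] : p <= h0 /\ - p <= h0.
  by split; apply: real_ler_of_sqr; rewrite ?rpredN ?sqrrN ?h0E // ltW.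
(* The point of tangency relative to the centre; [dist] gives its distances to the foci, for [s = 1]
   and [s = -1]. *)
have [v vE] : {v | v = (b2 * c + p * e) / h0} by eexists.
have pC : p^* = p by rewrite conj_Creal.
have hC : h0^* = h0 by rewrite conj_Creal // gtr0_real.
have bC : b2^* = b2 by rewrite conj_Creal // gtr0_real.
have pE : c^* * e + c * e^* = 2 * p by rewrite pE0 dotE; field.
have dist s : s ^+ 2 = 1 -> 0 <= h0 - s * p -> `|v - s * e| = a * (h0 - s * p) / h0.
  move=> s1 hs; have sr : s^* = s.
    by move/eqP: s1; rewrite sqrf_eq1 => /orP[] /eqP ->; rewrite ?rmorphN rmorph1.
  apply/eqP; rewrite -(@eqrXn2 _ 2) ?divr_ge0 ?mulr_ge0 ?(ltW h00) ?(ltW a0) //; apply/eqP.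
  rewrite normCK vE !rmorphB !rmorphM fmorphV rmorphD !rmorphM /= sr pC hC bC.
  have a2E : a ^+ 2 = b2 + e * e^* by rewrite b2E normCK subrK.
  apply: (mulIf (expf_neq0 2 hne)).
  have -> : (a * (h0 - s * p) / h0) ^+ 2 * h0 ^+ 2 = (b2 + e * e^*) * (h0 - s * p) ^+ 2.
    by rewrite -a2E; field.
  have -> : ((b2 * c + p * e) / h0 - s * e) * ((b2 * c^* + p * e^*) / h0 - s * e^*) * h0 ^+ 2 =
     b2 * (b2 * (c * c^*)) + b2 * (p - s * h0) * (c^* * e + c * e^*)
     + (p ^+ 2 + s ^+ 2 * h0 ^+ 2 - 2 * s * p * h0) * (e * e^*) by field.
  have h0E' : b2 * (c * c^*) = h0 ^+ 2 - p ^+ 2 by rewrite h0E normCK addrK.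
  rewrite pE h0E' s1 mul1r.
  have -> : (h0 - s * p) ^+ 2 = h0 ^+ 2 + s ^+ 2 * p ^+ 2 - 2 * s * p * h0 by ring.
  by rewrite s1 mul1r; ring.
have rE : r = 'Re (c^* * m) + h0.
  apply/le_anti/andP; split.
    rewrite -hr; pose y := z1 - m; pose h := 'Re (c^* * y).
    have -> : 'Re (c^* * z1) = 'Re (c^* * m) + h by rewrite -raddfD /= -mulrDr subrKC.
    rewrite lerD2l; apply: real_ler_of_sqr; rewrite ?Creal_Re ?(ltW h00) //.
    pose q := 'Im (c^* * e).
    (* The left side is the modulus of a sum of terms of moduli [|c| * |y - e|] and [|c| * |y + e|],
       which total [|c| * d]. *)
    have tri : `|2 * (h + 'i * q)| <= `|c| * d.
      have -> : 2 * (h + 'i * q) = (c^* * (y - e))^* + c^* * (y + e).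
        rewrite /h /q ReE ImE !rmorphM !rmorphB /= conjCK.
        have i2 : 'i * ('i * (c * e^* - c^* * e) / 2) = - (c * e^* - c^* * e) / 2 :> C.
          by rewrite !mulrA -expr2 sqrCi mulN1r.
        by rewrite mulrDr i2; field.
      apply: le_trans (ler_normD _ _) _; rewrite norm_conjC !normrM norm_conjC -mulrDr.
      rewrite -hz1 /y f1E f2E.
      have -> : z1 - m - e = z1 - (m + e) by ring.
      by have -> : z1 - m + e = z1 - (m - e) by ring.
    have sq : `|h + 'i * q| ^+ 2 = h ^+ 2 + q ^+ 2 by rewrite normC2_rect ?Creal_Re ?Creal_Im.
    have pq : p ^+ 2 + q ^+ 2 = `|c| ^+ 2 * `|e| ^+ 2.
      by rewrite -(@normC2_rect _ p q) // ?Creal_Re ?Creal_Im // pE0 -Crect normrM norm_conjC exprMn.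
    have : `|h + 'i * q| <= `|c| * a.
      by move: tri; rewrite normrM n2 dE mulrCA ler_pM2l ?ltr0n.
    rewrite -(@ler_pXn2r _ 2) ?nnegrE ?mulr_ge0 ?(ltW a0) // sq => hq.
    have -> : h0 ^+ 2 = (`|c| * a) ^+ 2 - q ^+ 2.
      rewrite h0E exprMn b2E; have -> : p ^+ 2 = `|c| ^+ 2 * `|e| ^+ 2 - q ^+ 2.
        by rewrite -pq addrK.
      by ring.
    by rewrite lerBrDr.
  have hv : 'Re (c^* * v) = h0.
    have vC : v^* = (b2 * c^* + p * e^*) / h0.
      by rewrite vE rmorphM fmorphV rmorphD !rmorphM /= pC hC bC.
    rewrite dotE vC vE.
    have -> : (c^* * ((b2 * c + p * e) / h0) + c * ((b2 * c^* + p * e^*) / h0)) / 2 =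
       (b2 * (c * c^*) + p * ((c^* * e + c * e^*) / 2)) / h0 by field.
    have -> : p * ((c^* * e + c * e^*) / 2) = p ^+ 2 by rewrite pE; field.
    by rewrite -normCK -h0E expr2 mulfK.
  have <- : 'Re (c^* * (m + v)) = 'Re (c^* * m) + h0 by rewrite mulrDr raddfD /= hv.
  apply: hle; rewrite f1E f2E.
  have -> : m + v - (m + e) = v - 1 * e by ring.
  have -> : m + v - (m - e) = v - (-1) * e by ring.
  rewrite !dist ?sqrrN ?expr1n ?mul1r ?mulN1r ?opprK ?subr_ge0 //.
    by rewrite dE; field.
  by rewrite -(opprK p) subr_ge0.
have -> : 'Re (c^* * f1) = 'Re (c^* * m) + p by rewrite f1E mulrDr raddfD /= -pE0.
have -> : 'Re (c^* * f2) = 'Re (c^* * m) - p by rewrite f2E mulrBr raddfB /= -pE0.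
rewrite rE.
have -> : 4 * (('Re (c^* * m) + h0 - ('Re (c^* * m) + p)) * ('Re (c^* * m) + h0 - ('Re (c^* * m) - p)))
   = 4 * (h0 ^+ 2 - p ^+ 2) by ring.
rewrite h0E addrK mulrA; congr (_ * _).
by rewrite b2E feE dE; ring.
Qed.

Lemma orient_dot u v w : orient u v w = 'Re (('i * (v - u))^* * w) - 'Re (('i * (v - u))^* * u).
Proof.
rewrite -raddfB /= -mulrBr orientE dotE !rmorphM !rmorphB /= conjCi.
by field.
Qed.

(** The product of the signed distances of the foci from a tangent is constant: this is
    [ellipse_support] with normal ['i * (v - u)]. On the circle conjugates are inverses, which makes
    the identity polynomial in [u] and [v]. *)
Lemma chord_tangent f1 f2 d u v :
  `|f1 - f2| < d -> `|u| = 1 -> `|v| = 1 -> u != v ->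
  (forall z, `|z - f1| + `|z - f2| = d -> orient u v z <= 0) ->
  (exists2 z, `|z - f1| + `|z - f2| = d & orient u v z = 0) ->
  (u + v - f1 - u * v * f1^*) * (u + v - f2 - u * v * f2^*) =
    (d ^+ 2 - `|f1 - f2| ^+ 2) * (u * v).
Proof.
move=> hd hu hv uv hle [z hz oz]; pose c := 'i * (v - u).
have [u0 v0] := (circle_neq0 hu, circle_neq0 hv).
have vu0 : v - u != 0 by rewrite subr_eq0 eq_sym.
have c0 : c != 0 by rewrite mulf_neq0 ?neq0Ci.
have key : 4 * (orient u v f1 * orient u v f2) = (d ^+ 2 - `|f1 - f2| ^+ 2) * `|c| ^+ 2.
  have -> : orient u v f1 * orient u v f2 =
      ('Re (c^* * u) - 'Re (c^* * f1)) * ('Re (c^* * u) - 'Re (c^* * f2)).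
    by rewrite !orient_dot -/c; ring.
  apply: ellipse_support => // [w hw|]; first by rewrite -subr_le0 -orient_dot hle.
  by exists z => //; apply/eqP; rewrite -subr_eq0 -orient_dot oz.
have oE f : orient u v f = - 'i * (v - u) / (2 * (u * v)) * (u + v - f - u * v * f^*).
  by rewrite orientE (circle_conj hu) (circle_conj hv); field; rewrite u0 v0.
rewrite !oE /c normrM normCi mul1r [`|v - u| ^+ 2]normCK in key.
move: key; rewrite rmorphB /= (circle_conj hu) (circle_conj hv).
move=> key.
have nz : - (v - u) ^+ 2 / (u * v) ^+ 2 != 0.
  by rewrite mulf_neq0 ?oppr_eq0 ?invr_eq0 ?expf_neq0 ?mulf_neq0.
apply: (mulfI nz).
have -> : - (v - u) ^+ 2 / (u * v) ^+ 2 * ((d ^+ 2 - `|f1 - f2| ^+ 2) * (u * v)) =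
  (d ^+ 2 - `|f1 - f2| ^+ 2) * ((v - u) * (v^-1 - u^-1)) by field; rewrite u0 v0.
rewrite -key.
have -> : - 'i * (v - u) / (2 * (u * v)) * (u + v - f1 - u * v * f1^*)
    * (- 'i * (v - u) / (2 * (u * v)) * (u + v - f2 - u * v * f2^*)) =
  'i ^+ 2 * ((v - u) / (2 * (u * v)) * (u + v - f1 - u * v * f1^*)
    * ((v - u) / (2 * (u * v)) * (u + v - f2 - u * v * f2^*))) by ring.
by rewrite sqrCi; field; rewrite u0 v0.
Qed.

(* If [1 - f1^* x = 0] then [f1 = x] and the equation degenerates to [- K x y = 0], which does not
   have two distinct nonzero roots. *)
Lemma chord_quadratic f1 f2 K x y y' : `|x| = 1 -> K != 0 -> y != y' ->
  let tangent v := (x + v - f1 - x * v * f1^*) * (x + v - f2 - x * v * f2^*) = K * (x * v) in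
  tangent y -> tangent y' ->
  let q2 := (1 - f1^* * x) * (1 - f2^* * x) in
  let q1 := (1 - f1^* * x) * (x - f2) + (x - f1) * (1 - f2^* * x) - K * x in
  let q0 := (x - f1) * (x - f2) in
  [/\ q2 != 0, y + y' = - (q1 / q2) & y * y' = q0 / q2].
Proof.
move=> hx K0 yy' tangent t t' q2 q1 q0; have x0 := circle_neq0 hx.
have e : q2 * y ^+ 2 + q1 * y + q0 = 0.
  by move/eqP: t; rewrite -subr_eq0 => /eqP <-; rewrite /q2 /q1 /q0; ring.
have e' : q2 * y' ^+ 2 + q1 * y' + q0 = 0.
  by move/eqP: t'; rewrite -subr_eq0 => /eqP <-; rewrite /q2 /q1 /q0; ring.
have d0 : y - y' != 0 by rewrite subr_eq0.
have s : q2 * (y + y') + q1 = 0.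
  apply: (mulIf d0); rewrite mul0r -[RHS](subrr 0) -{1}e -e'; ring.
have q20 : q2 != 0.
  apply/negP => /eqP h; move: s; rewrite h mul0r add0r => h1.
  have deg f : 1 - f^* * x = 0 -> x - f = 0.
    move/(congr1 (fun t => t^*)); rewrite rmorphB rmorphM rmorph1 rmorph0 /= conjCK (circle_conj hx).
    by move=> hf; rewrite -[RHS](mulr0 x) -hf; field.
  move/eqP: h; rewrite mulf_eq0 => /orP[] /eqP h; move: h1; rewrite /q1 h (deg _ h);
    move/eqP; rewrite !(mul0r, mulr0, add0r, addr0, sub0r) oppr_eq0 mulf_eq0 (negbTE K0) (negbTE x0) //.
have sE : y + y' = - (q1 / q2).
  by apply: (mulfI q20); rewrite mulrN mulrCA divff // mulr1; apply/eqP; rewrite -addr_eq0 s.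
split=> //; apply: (mulfI q20); rewrite [RHS]mulrCA divff // mulr1.
have -> : q2 * (y * y') = q2 * y * (y + y') - q2 * y ^+ 2 by ring.
rewrite sE -[RHS]addr0 -[in RHS]oppr0 -e; field.
by [].
Qed.

End Ellipse.

(** * Blaschke curves *)

Section Curve.
Variable R : realType.
Local Notation C := R[i].

Lemma blaschke_seqE n (g : C) (a : n.-tuple C) z :
  blaschke g a z = (g *: bnum a).[z] / (bden a).[z].
Proof.
rewrite hornerZ bnumE bdenE -mulrA -prodf_div /blaschke; congr (_ * _).
by rewrite [RHS]big_tuple.
Qed.

Lemma in_disk_tuple n (g : C) (a : n.-tuple C) : blaschke_data g a -> in_disk a.
Proof. by case=> _ h x /tnthP[j ->]. Qed.

Lemma blaschke_decomposition_of_seqs n k (g : C) (a : n.-tuple C) (gC : C) (cs d : seq C) :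
  `|gC| = 1 -> size cs = k /\ in_disk cs -> size d = (n %/ k)%N /\ in_disk d ->
  (forall z, `|z| <= 1 -> (g *: bnum a).[z] / (bden a).[z] =
      gC * \prod_(c <- cs) (((bnum d).[z] / (bden d).[z] - c)
                            / (1 - c^* * ((bnum d).[z] / (bden d).[z])))) ->
  exists (gC : C) (c : k.-tuple C) (gD : C) (d : (n %/ k).-tuple C),
    blaschke_data gC c /\ blaschke_data gD d /\
    forall z : C, `|z| <= 1 -> blaschke g a z = blaschke gC c (blaschke gD d z).
Proof.
move=> hg [/eqP sc hc] [/eqP sd hd] h.
exists gC, (Tuple sc), 1, (Tuple sd); split; [|split].
- by split=> // j; apply: hc; rewrite mem_tnth.
- by split; [rewrite normr1 | move=> j; apply: hd; rewrite mem_tnth].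
move=> z hz; rewrite blaschke_seqE h // [blaschke 1 _ _]blaschke_seqE scale1r.
by rewrite /blaschke; congr (_ * _); exact: (big_tuple _ _ (Tuple sc)).
Qed.

Variables (n : nat) (g : C) (a : n.-tuple C).
Hypothesis n2 : (2 < n)%N.
Hypothesis data : blaschke_data g a.
Variables (f1 f2 : C) (ax : R).
Hypothesis nondeg : nondeg_ellipse f1 f2 ax.
Hypothesis curve : blaschke_curve_is (blaschke g a) (ellipse f1 f2 ax).

Local Notation num := (g *: bnum a).
Local Notation den := (bden a).
Local Notation K := (((2 * ax)%:C%C : C) ^+ 2 - `|f1 - f2| ^+ 2).

Let a_disk : in_disk a := in_disk_tuple data.
Let g1 : `|g| = 1 := data.1.
Let a0 : tval a != [::]. Proof. by rewrite -size_eq0 size_tuple; lia. Qed.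
Let den0 (z : C) : `|z| = 1 -> den.[z] != 0.
Proof. by move=> hz; rewrite bden_neq0 ?hz. Qed.

Lemma vertexP (z w : C) : `|z| = 1 ->
  vertex (blaschke g a) (blaschke g a z) w <-> `|w| = 1 /\ root (level num den z) w.
Proof.
move=> hz; rewrite /vertex !blaschke_seqE.
split=> -[hw h]; split=> //; first by apply/(level_root num den0 hz hw).
by apply/esym/(level_root num den0 hz hw).
Qed.

(** The ellipse lies in the polygon, hence on one side of the edge, and it touches the edge. *)
Lemma side_tangent (lam u v : C) : `|lam| = 1 -> `|u| = 1 -> `|v| = 1 ->
  vertex (blaschke g a) lam u -> vertex (blaschke g a) lam v -> u != v ->
  (forall w, vertex (blaschke g a) lam w -> orient u v w <= 0) ->
  (u + v - f1 - u * v * f1^*) * (u + v - f2 - u * v * f2^*) = K * (u * v).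
Proof.
move=> hl hu hv vu vv uv hle; have [c1 [c2 _]] := curve.
apply: chord_tangent => //.
  move=> z /(c1 _ hl _) hz.
  rewrite orient_dot subr_le0 -(complexRe (_ * u)); apply: hz => w vw.
  by rewrite complexRe -subr_le0 -orient_dot hle.
have [|z [hz [t [_ ez]]]] := c2 lam hl u v.
  by split=> //; split=> //; split; [apply/eqP | right].
exists z => //; rewrite /orient ez [u + _]addrC addrK mulrCA -normCKC ImE.
have tr : (t%:C%C : C)^* = t%:C%C by apply/CrealP; rewrite complex_real.
by rewrite rmorphM rmorphXn /= conj_normC tr subrr mulr0 mul0r.
Qed.

(** Together with [tan1] and [tan0]: the tangency equation of a chord as a quadratic in one end,
    with coefficients polynomial in the other. *)
Definition tan2 : {poly C} := (1 - f1^* *: 'X) * (1 - f2^* *: 'X).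
Definition tan1 : {poly C} :=
  (1 - f1^* *: 'X) * ('X - f2%:P) + ('X - f1%:P) * (1 - f2^* *: 'X) - K *: 'X.
Definition tan0 : {poly C} := ('X - f1%:P) * ('X - f2%:P).

Definition poncelet_cycle (z : C) (x : nat -> C) : Prop :=
  [/\ x 0%N = z, forall i, x (i + n)%N = x i, forall i, `|x i| = 1,
      forall i j, (i < n)%N -> (j < n)%N -> x i = x j -> i = j &
      level num den z = (level num den z)`_n *: \prod_(0 <= i < n) ('X - (x i)%:P) /\
      forall i, [/\ tan2.[x i.+1] != 0,
         x i + x i.+2 = - (tan1.[x i.+1] / tan2.[x i.+1]) &
         x i * x i.+2 = tan0.[x i.+1] / tan2.[x i.+1]]].

Lemma exists_poncelet_cycle (z : C) : `|z| = 1 -> exists x, poncelet_cycle z x.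
Proof.
move=> hz.
have [rs [urs srs hrs eL]] := level_set g1 a_disk a0 hz.
rewrite size_tuple in srs eL.
have zrs : z \in rs by apply/hrs; split=> //; apply: level_self.
have [||x [x0 xper xperm xor]] := cyclic_enumeration urs _ zrs.
- by move=> w /hrs[].
- by rewrite srs ltnW.
rewrite srs in xper xperm.
have xin i : x i \in rs.
  have xm j : x (i %% n + j * n)%N = x (i %% n)%N.
    by elim: j => [|j IH]; rewrite ?mul0n ?addn0 // mulSnr addnA xper.
  rewrite (divn_eq i n) addnC xm -(perm_mem xperm); apply: map_f.
  by rewrite mem_iota /= ltn_pmod; lia.
have xnorm i : `|x i| = 1 by have /hrs[] := xin i.
have xinj i j : (i < n)%N -> (j < n)%N -> x i = x j -> i = j.
  move=> hi hj; have : uniq [seq x i | i <- iota 0 n] by rewrite (perm_uniq xperm).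
  by move/mkseq_uniqP/(_ i j); apply.
(* Used for [m = 1], the ends of an edge, and for [m = 2], the two neighbours of a vertex, which
   differ because [n > 2]. *)
have xne i m : (0 < m)%N -> (m < n)%N -> x i != x (i + m)%N.
  move=> m0 mn; apply/negP => /eqP e.
  have xm j : x (j %% n)%N = x j.
    rewrite [in RHS](divn_eq j n) addnC; move: (j %/ n)%N (j %% n)%N => b c.
    by elim: b => [|b IH]; rewrite ?mul0n ?addn0 // mulSnr addnA xper.
  have n0 : (0 < n)%N by lia.
  have /eqP : (i %% n)%N = ((i + m) %% n)%N by apply: xinj; rewrite ?ltn_pmod // !xm.
  rewrite -[X in (X %% _)%N == _]addn0 eqn_modDl mod0n modn_small //; lia.
have vert w : w \in rs -> vertex (blaschke g a) (blaschke g a z) w.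
  by move=> hw; apply/vertexP => //; apply/hrs.
have lam1 : `|blaschke g a z| = 1.
  rewrite blaschke_seqE normrM normfV norm_num_den // divff // normr_eq0; exact: den0.
have tang i : (x i + x i.+1 - f1 - x i * x i.+1 * f1^*) * (x i + x i.+1 - f2 - x i * x i.+1 * f2^*)
    = K * (x i * x i.+1).
  apply: (side_tangent lam1) => //; try exact: vert.
    by rewrite -addn1 xne //; lia.
  by move=> w /(vertexP _ hz)/hrs; apply: xor.
have K0 : K != 0.
  rewrite subr_eq0 gt_eqF // ltrXn2r //; exact: nondeg.
exists x; split=> //; split.
  rewrite {1}eL; congr (_ *: _); rewrite -(perm_big _ xperm) big_map /index_iota subn0 //.
move=> i; have ne : x i != x i.+2 by rewrite -addn2 xne.
(* The tangency equation is symmetric; both edges at [x i.+1] are written with that vertex first. *)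
have t1 := tang i; rewrite ![x i + _]addrC ![x i * _]mulrC in t1.
have [q0 q1 q2] := chord_quadratic (xnorm i.+1) K0 ne t1 (tang i.+1).
by rewrite /tan2 /tan1 /tan0 -polyC1 !(hornerM, hornerD, hornerN, hornerZ, hornerX, hornerC).
Qed.

Lemma decomposition_of_curve k : (1 < k)%N -> (k %| n)%N ->
  exists gC cs d, [/\ `|gC| = 1, size cs = k /\ in_disk cs, size d = (n %/ k)%N /\ in_disk d &
    forall z, `|z| <= 1 -> num.[z] / den.[z] =
      gC * \prod_(c <- cs) (((bnum d).[z] / (bden d).[z] - c)
                            / (1 - c^* * ((bnum d).[z] / (bden d).[z])))].
Proof.
move=> k1 /dvdnP[m nm].
have k0 : (0 < k)%N by exact: ltnW.
have nkm : n = (k * m)%N by rewrite nm mulnC.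
have m0 : (0 < m)%N by move: n2; rewrite nm; case: (m).
have ex (z : C) : exists x, `|z| = 1 -> poncelet_cycle z x.
  case: (eqVneq `|z| 1) => [/exists_poncelet_cycle[x hx]|h]; first by exists x.
  by exists (fun=> 0) => /eqP; rewrite (negbTE h).
have [x hx] := choice ex.
have tan_size : [/\ (size tan2 <= 3)%N, (size tan1 <= 3)%N & (size tan0 <= 3)%N].
  have s1 f : (size (1 - f *: 'X : {poly C})%R <= 2)%N.
    rewrite (leq_trans (size_polyD _ _)) // geq_max size_poly1 size_polyN.
    by rewrite (leq_trans (size_scale_leq _ _)) ?size_polyX.
  have s2 (f : C) : (size ('X - f%:P)%R <= 2)%N by rewrite size_XsubC.
  have s3 (p q : {poly C}) : (size p <= 2)%N -> (size q <= 2)%N -> (size (p * q)%R <= 3)%N.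
    move=> hp hq; rewrite (leq_trans (size_polyMleq _ _)) //.
    by move: hp hq; move: (size p) (size q) => u v; lia.
  split; rewrite ?s3 //.
  rewrite (leq_trans (size_polyD _ _)) // geq_max size_polyN.
  rewrite (leq_trans (size_polyD _ _)) ?geq_max ?s3 //=.
  by rewrite (leq_trans (size_scale_leq _ _)) ?size_polyX.
have t2 z : `|z| = 1 -> tan2.[z] != 0.
  move=> hz; have [x0 per _ _ [_ h]] := hx z hz; have [h2 _ _] := h n.-1.
  by move: h2; rewrite prednK ?(ltnW (ltnW n2)) // -[n]add0n per x0.
have lead0 z : `|z| = 1 -> (level num den z)`_n != 0.
  by move=> hz; have := level_lead_neq0 g1 a_disk a0 hz; rewrite size_tuple.
have [|||||||P [Q [c [ts [hP hQ sts e]]]]] :=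
  @num_pencil C num den n x tan2 tan1 tan0 n2 den0 _ _ _ _ _ lead0 tan_size t2 _ _ k m nkm.
- by move=> z /hx[].
- by move=> z i /hx[].
- by move=> z i /hx[].
- by move=> z i j /hx[_ _ _ h _]; apply: h.
- by move=> z /hx[_ _ _ _ []].
- by move=> z i /hx[_ _ _ _ [_ h]]; have [] := h i.
- by move=> z i /hx[_ _ _ _ [_ h]]; have [] := h i.
have -> : (n %/ k)%N = m by rewrite nkm mulKn.
by apply: (blaschke_from_pencil g1 a_disk k0 m0 _ hP hQ sts e); rewrite size_tuple.
Qed.

End Curve.

Theorem theorem3p5 (R : realType) (n : nat) (g : R[i]) (a : n.-tuple R[i]) :
  (0 < n)%N ->
  blaschke_data g a ->
  blaschke_curve_is_ellipse (blaschke g a) ->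
  forall k : nat, (1 < k)%N -> (k %| n)%N ->
  exists (gC : R[i]) (c : k.-tuple R[i]) (gD : R[i]) (d : (n %/ k).-tuple R[i]),
    blaschke_data gC c /\ blaschke_data gD d /\
    forall z : R[i], `|z| <= 1 ->
      blaschke g a z = blaschke gC c (blaschke gD d z).
Proof.
move=> n0 data [f1 [f2 [ax [nondeg curve]]]] k k1 kn.
(* For [n <= 2] the factor [k] equals [n], and the inner product is the identity, with its only zero
   at 0. *)
case: (leqP n 2) => n2.
  have nk : n = k by have := dvdn_leq n0 kn; lia.
  apply: (@blaschke_decomposition_of_seqs _ _ _ g a g a [:: 0]).
  - by case: data.
  - by rewrite size_tuple; split=> //; apply: in_disk_tuple data.
  - by rewrite -nk divnn n0; split=> // x; rewrite inE => /eqP ->; rewrite normr0 ltr01.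
  move=> z _; rewrite hornerZ !bnumE !bdenE !big_seq1 rmorph0 mul0r !subr0 divr1.
  by rewrite -mulrA prodf_div.
have [gC [cs [d [h1 h2 h3 h4]]]] := decomposition_of_curve n2 data nondeg curve k1 kn.
exact: blaschke_decomposition_of_seqs h1 h2 h3 h4.
Qed.
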